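(* Let $d\in\mathbb N$ and let $\mathcal H$ be a unitarily invariant complete NP-space (on $\mathbb B_d$ or on $\overline{\mathbb B_d}$) with reproducing kernel $K(z,w)=\sum_{n=0}^\infty a_n\langle z,w\rangle^n$. Consider the following conditions: (a) Gleason's problem can be solved in $\operatorname{Mult}(\mathcal H)$. That is, given $\lambda\in\mathbb B_d$ and $\varphi\in\operatorname{Mult}(\mathcal H)$, there are $\varphi_1,\dots,\varphi_d\in\operatorname{Mult}(\mathcal H)$ such that $\varphi-\varphi(\lambda)=\sum_{i=1}^d(z_i-\lambda_i)\varphi_i$. (b) For every $\lambda\in\mathbb B_d$, the space $\sum_{i=1}^d(z_i-\lambda_i)\mathcal H\subset\mathcal H$ is closed in $\mathcal H$. (c) The condition $\lim_{n\to\infty}\frac{a_n}{a_{n+1}}=1$ holds. Then (c) $\Rightarrow$ (b) $\Rightarrow$ (a), and each of (a), (b), (c) implies that $\mathcal H$ is tame.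
   Context: Reproducing kernel Hilbert spaces are separable complex Hilbert spaces of functions on a set. For such a space $\mathcal H$ on $X$ with kernel $K$, $\operatorname{Mult}(\mathcal H)$ is the algebra of all $\varphi : X \to \mathbb C$ with $\varphi\mathcal H \subset \mathcal H$, with norm $\|\varphi\|=\|M_\varphi\|$, $M_\varphi f=\varphi f$. $\mathcal H$ is irreducible if $K(x,y) \ne 0$ for all $x,y\in X$ and $K(\cdot,x),K(\cdot,y)$ are linearly independent for $x\neq y$. $\mathcal H$ is a complete Nevanlinna-Pick space if for all $n,r \ge 1$, $z_1,\dots,z_n\in X$ and $\Lambda_1,\dots,\Lambda_n \in M_r(\mathbb C)$ such that the block matrix $\big(K(z_i,z_j)(1-\Lambda_i\Lambda_j^* )\big)_{i,j}$ is positive semidefinite, there is $\Phi \in M_r(\operatorname{Mult}(\mathcal H))$ of norm at most $1$ (as an operator on $\mathcal H\otimes\mathbb C^r$) with $\Phi(z_i)=\Lambda_i$ for all $i$. If $1 \in \mathcal H$, a non-zero bounded linear functional $\rho$ on $\mathcal H$ is partially multiplicative if $\rho(\varphi f)=\rho(\varphi)\rho(f)$ for all $\varphi\in\operatorname{Mult}(\mathcal H)$, $f\in\mathcal H$; $\mathcal H$ is algebraically consistent (on $X$) if every such $\rho$ is evaluation at a point of $X$. Here $d$ is finite and $\mathbb B_d$ is the open unit ball of $\mathbb C^d$. A unitarily invariant complete NP-space on $\mathbb B_d$ is a reproducing kernel Hilbert space on $\mathbb B_d$ with kernel $K(z,w)=\sum_{n\ge0}a_n\langle z,w\rangle^n$,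 $a_0=1$, $a_n\ge0$, which contains the coordinate functions, is algebraically consistent on $\mathbb B_d$, and is an irreducible complete Nevanlinna-Pick space. A unitarily invariant complete NP-space on $\overline{\mathbb B_d}$ is defined in the same way with $\overline{\mathbb B_d}$ in place of $\mathbb B_d$ (the functions being analytic on $\mathbb B_d$ and continuous on $\overline{\mathbb B_d}$, and the space being algebraically consistent on $\overline{\mathbb B_d}$). Equivalently: $a_1>0$, $\sum a_nt^n$ has radius of convergence $1$, the Taylor coefficients at $0$ of $1-1/\sum a_nt^n$ are non-negative, and $\sum a_n=\infty$ (for $\mathbb B_d$), respectively $\sum a_n<\infty$ (for $\overline{\mathbb B_d}$). All polynomials are multipliers of such a space, and all $a_n>0$. $\mathcal H$ is tame if every character (non-zero multiplicative linear functional) $\rho$ on $\operatorname{Mult}(\mathcal H)$ with $\lambda=(\rho(z_1),\dots,\rho(z_d))\in\mathbb B_d$ is evaluation at $\lambda$. *)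

(* Defs.v *)
From HB Require Import structures.
From mathcomp Require Import all_boot all_order all_algebra sesquilinear.
From mathcomp Require Import complex.
From mathcomp Require Import all_classical all_reals all_analysis.

Set Implicit Arguments.
Unset Strict Implicit.
Unset Printing Implicit Defensive.

Import Order.TTheory GRing.Theory Num.Theory.
Import numFieldNormedType.Exports.

Local Open Scope classical_set_scope.
Local Open Scope complex_scope.
Local Open Scope sesquilinear_scope.
Local Open Scope ring_scope.

(* The Hilbert space is a complete normed module whose norm comes from [dot]
   (linear in the first argument); its elements are identified with functions
   on [X] through the injective linear map [ev].  [kelt y] is the kernel
   function K(., y); its existence amounts to the boundedness of the evaluation
   at y. *)
Record rkhs (R : realType) (X : Type) := Rkhs {
  rkhs_space :> completeNormedModType R[i];
  dot : {dot rkhs_space for @Num.conj R[i]};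
  dot_norm : forall f : rkhs_space, `|f| ^+ 2 = dot f f;
  rkhs_separable : exists2 S : set rkhs_space, countable S & dense S;
  ev : {linear rkhs_space -> (X -> R[i]^o)};
  ev_inj : injective ev;
  kelt : X -> rkhs_space;
  kelt_repro : forall (f : rkhs_space) (y : X), dot f (kelt y) = ev f y }.

Definition kernel (R : realType) (X : Type) (H : rkhs R X) (x y : X) : R[i] :=
  ev H (kelt H y) x.

Definition Mult (R : realType) (X : Type) (H : rkhs R X) : set (X -> R[i]) :=
  [set phi | forall f : H, exists g : H, forall x, ev H g x = phi x * ev H f x].

Definition irreducible (R : realType) (X : Type) (H : rkhs R X) : Prop :=
  (forall x y : X, kernel H x y != 0) /\
  (forall x y : X, x <> y -> forall c e : R[i],
     (forall u, c * kernel H u x + e * kernel H u y = 0) -> c = 0 /\ e = 0).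

(* For complex scalars [0 <= c] says that c is real and non-negative. *)
Definition posemidef (R : realType) (m : nat) (A : 'M[R[i]]_m) : Prop :=
  forall v : 'cV[R[i]]_m, 0 <= (v ^t Num.conj *m A *m v) 0 0.

(* [Phi] in M_r(Mult(H)) has norm at most 1 on H (x) C^r = H^r. *)
Definition contractive_mult (R : realType) (X : Type) (H : rkhs R X) (r : nat)
    (Phi : X -> 'M[R[i]]_r) : Prop :=
  (forall i j, Mult H (fun x => Phi x i j)) /\
  (forall f g : 'I_r -> H,
     (forall i x, ev H (g i) x = \sum_j Phi x i j * ev H (f j) x) ->
     \sum_i `|g i| ^+ 2 <= \sum_i `|f i| ^+ 2).

Definition complete_nevanlinna_pick (R : realType) (X : Type) (H : rkhs R X) :
    Prop :=
  forall (n r : nat), (0 < n)%N -> (0 < r)%N ->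
  forall (z : 'I_n -> X) (Lam : 'I_n -> 'M[R[i]]_r),
    posemidef (\mxblock_(i < n, j < n)
      (kernel H (z i) (z j) *: (1%:M - Lam i *m (Lam j) ^t Num.conj))) ->
    exists2 Phi : X -> 'M[R[i]]_r,
      contractive_mult H Phi & forall i, Phi (z i) = Lam i.

(* As 1 is in H, every multiplier is an element of H. *)
Definition partially_multiplicative (R : realType) (X : Type) (H : rkhs R X)
    (rho : {linear H -> R[i]^o}) : Prop :=
  [/\ continuous rho, exists f : H, rho f != 0 &
      forall p f g : H, Mult H (ev H p) ->
        (forall x, ev H g x = ev H p x * ev H f x) -> rho g = rho p * rho f].

Definition algebraically_consistent (R : realType) (X : Type) (H : rkhs R X) :
    Prop :=
  (exists e : H, forall x, ev H e x = 1) /\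
  (forall rho : {linear H -> R[i]^o}, partially_multiplicative rho ->
     exists x : X, forall f : H, rho f = ev H f x).

Definition cdot (R : realType) (d : nat) (z w : 'rV[R[i]]_d) : R[i] :=
  \sum_(i < d) z 0 i * Num.conj (w 0 i).

Definition oball (R : realType) (d : nat) : set 'rV[R[i]]_d :=
  [set z | cdot z z < 1].

Definition cball (R : realType) (d : nat) : set 'rV[R[i]]_d :=
  [set z | cdot z z <= 1].

Arguments oball : clear implicits.
Arguments cball : clear implicits.

Definition coord (R : realType) (d : nat) (D : set 'rV[R[i]]_d) (i : 'I_d)
    (z : D) : R[i] := val z 0 i.

(* [D] is meant to be [oball R d] or [cball R d]. *)
Definition unitarily_invariant_cnp (R : realType) (d : nat)
    (D : set 'rV[R[i]]_d) (H : rkhs R D) (a : nat -> R) : Prop :=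
  [/\ a 0%N = 1 /\ (forall n, 0 <= a n),
      forall z w : D,
        series (fun n => (a n)%:C * cdot (val z) (val w) ^+ n : R[i]^o) @ \oo
          --> (kernel H z w : R[i]^o),
      forall i : 'I_d, exists f : H, forall z, ev H f z = coord i z,
      algebraically_consistent H &
      irreducible H /\ complete_nevanlinna_pick H].

(* A functional on Mult(H) is given by its values on [Mult H]; the values of
   [rho] elsewhere are irrelevant. *)
Definition is_character (R : realType) (X : Type) (H : rkhs R X)
    (rho : (X -> R[i]) -> R[i]) : Prop :=
  [/\ forall (c : R[i]) (phi psi : X -> R[i]), Mult H phi -> Mult H psi ->
        rho (fun x => c * phi x + psi x) = c * rho phi + rho psi,
      forall phi psi : X -> R[i], Mult H phi -> Mult H psi ->
        rho (fun x => phi x * psi x) = rho phi * rho psi &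
      exists2 phi, Mult H phi & rho phi != 0].

Definition tame (R : realType) (d : nat) (D : set 'rV[R[i]]_d) (H : rkhs R D) :
    Prop :=
  forall rho : (D -> R[i]) -> R[i], is_character H rho ->
  oball R d (\row_i rho (@coord R d D i)) ->
  exists2 l : D, val l = \row_i rho (@coord R d D i) &
    forall phi, Mult H phi -> rho phi = phi l.

Definition gleason_solvable (R : realType) (d : nat) (D : set 'rV[R[i]]_d)
    (H : rkhs R D) : Prop :=
  forall l : D, oball R d (val l) ->
  forall phi, Mult H phi ->
  exists2 psi : 'I_d -> D -> R[i], (forall i, Mult H (psi i)) &
    forall z, phi z - phi l = \sum_i (coord i z - coord i l) * psi i z.

Definition coordinate_range (R : realType) (d : nat) (D : set 'rV[R[i]]_d)
    (H : rkhs R D) (l : D) : set H :=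
  [set f | exists g : 'I_d -> H,
     forall z, ev H f z = \sum_i (coord i z - coord i l) * ev H (g i) z].

(* Main.v *)
Require Import Defs.
From mathcomp Require Import all_boot all_order all_algebra sesquilinear.
From mathcomp Require Import spectral.
From mathcomp Require Import complex.
From mathcomp Require Import all_classical all_reals all_analysis.
From mathcomp Require Import ring lra.
Import Order.TTheory GRing.Theory Num.Theory.
Import numFieldNormedType.Exports.
Local Open Scope classical_set_scope.
Local Open Scope complex_scope.
Local Open Scope ring_scope.

(** Every operator-theoretic statement below is phrased as positivity of a
    kernel on the domain.  The bridge is [range_criterion], a form of the Riesz
    representation theorem: functions [F_l] and [h] being given, the equation
    [h = \sum_l F_l * g_l] has a solution with [\sum_l |g_l|^2 <= B] in the
    space as soon as [B * K(x,y) * \sum_l F_l(x) F_l(y)^* - h(x) h(y)^*] is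
    positive semidefinite.  It yields criteria for membership in the space
    ([mem_criterion]), for being a multiplier ([mult_criterion]) and for lying
    in the range of a row of multipliers.

    The implication from (c) to (b).  The row operator [g |-> \sum_i z_i g_i]
    composed with its adjoint acts on homogeneous polynomials of degree [n] as
    the scalar [a_(n-1) / a_n].  When these ratios tend to 1, the adjoint of the
    row with entries [z_i - l_i], [|l| < 1], is bounded below up to a finite rank
    term built from polynomials; as a kernel inequality this is
    [range_kernel_bound].  By [range_criterion] every [f] is then
    [\sum_i (z_i - l_i) g_i] plus a polynomial, and a polynomial that vanishes
    at [l] lies in the range as well.  The range is thus the closed subspace
    of functions vanishing at [l].

    The implication from (b) to (a).  Kernel functions are norm limits of the
    partial sums of their power series ([kelt_approx]), so polynomials are dense,
    and a closed range must contain every function that vanishes at [l]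
    ([closed_range_full]).  If [phi] is a multiplier, all the products
    [(phi - phi(l)) u] thus lie in the range, and the uniform boundedness
    principle makes [K(x,y) * (B * <x - l, y - l> - chi(x) chi(y)^* )] positive
    for some [B], where [chi = phi - phi(l)].  The factorisation theorem of
    Leech, valid for complete Pick kernels, converts this into multipliers
    [phi_i].  Its proof needs that [1 - 1/K] is positive
    ([psd_reciprocal], the necessary half of the theorem of McCullough and
    Quiggin); on a finite set a lurking isometry then gives an explicit solution ([finite_leech]), and a limit along an
    ultrafilter of finite sets gives a solution on the whole domain ([leech]).

    That polynomials are multipliers also comes from positivity of [1 - 1/K]:
    tested at points close to the origin it shows that the Taylor coefficients
    of [1 - 1 / \sum_n a_n t^n] are non-negative, whence
    [a_1 * a_n <= a_(n+1)], and this bounds multiplication by coordinates.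

    Tameness.  If [rho] is a character with [rho(z_i) = l_i], applying it to
    [phi - phi(l) = \sum_i (z_i - l_i) phi_i] annihilates the right-hand side.
    Hence (a) implies tameness, and so do (b) and (c), which imply (a). *)

Set Implicit Arguments.
Unset Strict Implicit.
Unset Printing Implicit Defensive.

(** * Positive semidefinite kernels *)

Section PositiveKernels.
Variables (R : realType) (X : Type).
Local Notation C := R[i].
Implicit Types (L M : X -> X -> C) (s : seq (C * X)) (u : X -> C).

Definition quadform L s : C :=
  \sum_(p <- s) \sum_(q <- s) (p.1)^* * q.1 * L p.2 q.2.

Definition psd L := forall s, 0 <= quadform L s.

Lemma eq_psd L M : (forall x y, L x y = M x y) -> psd L -> psd M.
Proof.
move=> LM Lp s; have := Lp s; rewrite /quadform.
by under eq_bigr do under eq_bigr do rewrite LM.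
Qed.

Lemma psdD L M : psd L -> psd M -> psd (fun x y => L x y + M x y).
Proof.
move=> Lp Mp s; have := addr_ge0 (Lp s) (Mp s); rewrite /quadform -big_split /=.
congr (0 <= _); apply: eq_bigr => p _; rewrite -big_split /=.
by apply: eq_bigr => q _; rewrite mulrDr.
Qed.

Lemma psd_sum (I : Type) (r : seq I) (L : I -> X -> X -> C) :
  (forall i, psd (L i)) -> psd (fun x y => \sum_(i <- r) L i x y).
Proof.
move=> Lp; elim: r => [|i r IH].
  move=> s; rewrite /quadform !big1 // => p _; rewrite big1 // => q _.
  by rewrite big_nil mulr0.
by apply: eq_psd (psdD (Lp i) IH) => x y; rewrite big_cons.
Qed.

Lemma psd_conj_mul u L : psd L -> psd (fun x y => u x * L x y * (u y)^*).
Proof.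
move=> Lp s; have := Lp [seq ((u p.2)^* * p.1, p.2) | p <- s].
rewrite /quadform big_map; congr (0 <= _); apply: eq_bigr => p _.
rewrite big_map; apply: eq_bigr => q _ /=.
by rewrite rmorphM /= conjCK; ring.
Qed.

Lemma psdZ (c : C) L : 0 <= c -> psd L -> psd (fun x y => c * L x y).
Proof.
move=> c0 Lp s; have := mulr_ge0 c0 (Lp s); rewrite /quadform mulr_sumr.
congr (0 <= _); apply: eq_bigr => p _; rewrite mulr_sumr.
by apply: eq_bigr => q _; ring.
Qed.

Lemma psd_const1 : psd (fun _ _ => 1).
Proof.
move=> s; rewrite (_ : quadform _ s = (\sum_(p <- s) p.1)^* * \sum_(p <- s) p.1).
  by rewrite mulrC mul_conjC_ge0.
rewrite rmorph_sum mulr_suml; apply: eq_bigr => p _.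
by rewrite mulr_sumr; apply: eq_bigr => q _; rewrite mulr1.
Qed.

Lemma psd_rank1 u : psd (fun x y => u x * (u y)^*).
Proof. by apply: eq_psd (psd_conj_mul u psd_const1) => x y; rewrite mulr1. Qed.

Lemma psd_diag L x : psd L -> 0 <= L x x.
Proof. by move/(_ [:: (1, x)]); rewrite /quadform !big_seq1 /= rmorph1 !mul1r. Qed.

Lemma quadform_cat L s t : quadform L (s ++ t) =
  quadform L s + quadform L t +
  (\sum_(p <- s) \sum_(q <- t) (p.1)^* * q.1 * L p.2 q.2 +
   \sum_(p <- t) \sum_(q <- s) (p.1)^* * q.1 * L p.2 q.2).
Proof.
rewrite /quadform big_cat /=.
under eq_bigr do rewrite big_cat /=.
under [X in _ + X = _]eq_bigr do rewrite big_cat /=.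
by rewrite !big_split /=; ring.
Qed.

Lemma nneg_conj (z : C) : 0 <= z -> z^* = z.
Proof. by move/ger0_real/CrealP. Qed.

(** Polarisation: the form takes real values at the combinations [x + y] and
    [x + 'i y]. *)
Lemma psd_herm L x y : psd L -> L y x = (L x y)^*.
Proof.
move=> Lp; have := Lp [:: (1, x); (1, y)]; have := Lp [:: (1, x); ('i, y)].
rewrite /quadform !big_cons !big_nil /= !addr0 rmorph1 !mul1r !mulr1 conjCi.
have Lx := psd_diag x Lp; have Ly := psd_diag y Lp.
rewrite [- 'i * 'i]mulNr mulCii opprK mul1r => /nneg_conj + /nneg_conj.
rewrite !rmorphD /= !rmorphM /= !rmorphN /= conjCi (nneg_conj Lx) (nneg_conj Ly) opprK.
set a := L x y; set b := L y x; set a' := (L x y)^*; set b' := (L y x)^*.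
move=> e1 e2.
have {e1} : 'i * (a + a' - (b + b')) = 0.
  move/eqP: e1; rewrite -subr_eq0 => /eqP e1.
  rewrite -[RHS]oppr0 -e1; ring.
move/eqP; rewrite mulf_eq0 (negPf (neq0Ci _)) /= => /eqP e1.
have e2' : a' + b' - (a + b) = 0.
  move/eqP: e2; rewrite -subr_eq0 => /eqP e2; rewrite -[RHS]e2; ring.
apply/eqP; rewrite -subr_eq0; apply/eqP.
have -> : b - a' = - ((a + a' - (b + b')) + (a' + b' - (a + b))) / 2 by field.
by rewrite e1 e2' addr0 oppr0 mul0r.
Qed.

(** Schur complement of the diagonal entry at [w].  When [L w w] vanishes,
    positivity forces the row of [w] to vanish as well. *)
Lemma psd_schur_complement L w : psd L ->
  psd (fun x y => L w w * L x y - L x w * L w y).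
Proof.
move=> Lp s; set q := quadform L s; set l := \sum_(p <- s) p.1 * L w p.2.
have lJ : l^* = \sum_(p <- s) (p.1)^* * L p.2 w.
  rewrite /l rmorph_sum /=; apply: eq_bigr => p _.
  by rewrite rmorphM /= -(psd_herm _ _ Lp).
have -> : quadform (fun x y => L w w * L x y - L x w * L w y) s =
    L w w * q - l^* * l.
  rewrite lJ /q /l /quadform mulr_sumr mulr_suml -sumrB; apply: eq_bigr => p _.
  rewrite !mulr_sumr -sumrB; apply: eq_bigr => r _; ring.
have key c : 0 <= q + c^* * c * L w w + (c * l^* + c^* * l).
  have := Lp (s ++ [:: (c, w)]); rewrite quadform_cat -/q /quadform.
  rewrite !big_seq1 /=.
  under eq_bigr do rewrite big_seq1 /=.
  rewrite lJ /l !mulr_sumr; congr (0 <= _ + (_ + _)).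
    by apply: eq_bigr => p _; ring.
  by apply: eq_bigr => p _; ring.
have Lw := psd_diag w Lp; have q0 : 0 <= q by exact: Lp.
set m := l^* * l; have m0 : 0 <= m by rewrite /m mulrC mul_conjC_ge0.
have keyt t : 0 <= t -> 0 <= q + t ^+ 2 * m * L w w - t * m *+ 2.
  move=> t0; have := key (- (t * l)); rewrite rmorphN rmorphM /= (nneg_conj t0).
  by congr (0 <= _); rewrite /m mulr2n; ring.
have [L0|L0] := eqVneq (L w w) 0.
  rewrite L0 mul0r sub0r oppr_ge0.
  apply: contraT => m1.
  have {m1} mp : 0 < m by rewrite lt_neqAle m0 andbT; apply: contraNN m1 => /eqP <-.
  have t0 : 0 <= (q + 1) / m by rewrite divr_ge0 // addr_ge0.
  have := keyt _ t0; rewrite L0 mulr0 addr0 divfK ?gt_eqF //.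
  have -> : q - (q + 1) *+ 2 = - (q + 2) by rewrite mulr2n; ring.
  by rewrite oppr_ge0 => h; have := lt_le_trans (ltr_wpDl q0 (ltr0Sn _ 1)) h; rewrite ltxx.
have Lp0 : 0 < L w w by rewrite lt_neqAle eq_sym L0 Lw.
have := keyt (L w w)^-1; rewrite invr_ge0 => /(_ Lw) /(mulr_ge0 Lw).
by congr (0 <= _); rewrite mulr2n; field.
Qed.
End PositiveKernels.

(** * Complex limits *)

Section ComplexLimits.
Variable R : realType.
Local Notation C := R[i].

(** The distance from [z] to the half-line of non-negative numbers is at least
    half of [`|(`|z| - z)|]. *)
Lemma closed_nneg : closed [set z : C^o | 0 <= z].
Proof.
rewrite -[X in closed X]setCK; apply: open_closedC; rewrite openE => z /= zN.
have e0 : 0 < `|(`|z| - z)|.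
  by rewrite normr_gt0 subr_eq0; apply: contra_notN zN => /eqP <-.
apply/nbhs_ballP; exists (`|(`|z| - z)| / 2) => /=; first by rewrite divr_gt0.
move=> w; rewrite -ball_normE /= => zw w0.
suff : `|(`|z| - z)| < `|(`|z| - z)| by rewrite ltxx.
have {1}-> : `|z| - z = (`|z| - `|w|) + (w - z) by rewrite (ger0_norm w0); ring.
apply: le_lt_trans (ler_normD _ _) _; rewrite [ltRHS](splitr).
apply: ltrD; last by rewrite distrC.
by apply: le_lt_trans zw; exact: ler_dist_dist.
Qed.

Section Filters.
Context {T : Type} {F : set_system T} {FF : ProperFilter F}.
Implicit Types (f g : T -> C) (l : C).

(** Convergence of complex functions, kept opaque once its basic properties are
    known: unification otherwise unfolds it and searches through the sets of
    the two filters. *)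
Definition limC f l := (f : T -> C^o) @ F --> (l : C^o).

Lemma cvg_limC f l : (f : T -> C^o) @ F --> (l : C^o) -> limC f l.
Proof. by []. Qed.

Lemma limCP f l :
  limC f l <-> forall e : C, 0 < e -> \forall t \near F, `|l - f t| < e.
Proof. exact: (@cvgrPdist_lt C C^o). Qed.

Lemma limC_cst l : limC (fun=> l) l. Proof. exact: cvg_cst. Qed.

Lemma limCD f g l m : limC f l -> limC g m -> limC (fun t => f t + g t) (l + m).
Proof. exact: (@cvgD C C^o). Qed.

Lemma limCM f g l m : limC f l -> limC g m -> limC (fun t => f t * g t) (l * m).
Proof. exact: (@cvgM C). Qed.

Lemma limCZ (c : C) f l : limC f l -> limC (fun t => c * f t) (c * l).
Proof. by apply: limCM; exact: limC_cst. Qed.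

Lemma limCN f l : limC f l -> limC (fun t => - f t) (- l).
Proof. exact: (@cvgN C C^o). Qed.

Lemma limCJ f l : limC f l -> limC (fun t => (f t)^*) (l^*).
Proof.
move=> /limCP fl; apply/limCP => e /fl; apply: filterS => t.
by rewrite -rmorphB norm_conjC.
Qed.

Lemma limC_norm f l : limC f l -> limC (fun t => `|f t|) `|l|.
Proof.
move=> /limCP fl; apply/limCP => e /fl; apply: filterS => t.
by apply: le_lt_trans; exact: ler_dist_dist.
Qed.

Lemma limC_sum (I : Type) (r : seq I) (f : I -> T -> C) (l : I -> C) :
  (forall i, limC (f i) (l i)) ->
  limC (fun t => \sum_(i <- r) f i t) (\sum_(i <- r) l i).
Proof.
move=> fl; elim: r => [|i r IH].
  by rewrite big_nil; under eq_fun do rewrite big_nil; exact: limC_cst.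
by rewrite big_cons; under eq_fun do rewrite big_cons; exact: (limCD (fl i) IH).
Qed.

Lemma limC_ge0 f l : (\forall t \near F, 0 <= f t) -> limC f l -> 0 <= l.
Proof. move=> f0; exact: closed_cvg closed_nneg f0 l. Qed.

Lemma limC_unique f l m : limC f l -> limC f m -> l = m.
Proof. by apply: cvg_unique; exact: norm_hausdorff. Qed.

Lemma ge0_ReE (z : C) : 0 <= z -> z = (complex.Re z)%:C.
Proof. by move=> z0; rewrite RRe_real ?ger0_real. Qed.

Lemma near_limC f g l : (\forall t \near F, f t = g t) -> limC f l -> limC g l.
Proof. by move=> fg; apply: cvg_trans; exact: near_eq_cvg. Qed.
End Filters.
End ComplexLimits.
Global Opaque limC.

(** * Hilbert space geometry *)

Section HilbertSpace.
Variables (R : realType) (X : Type) (H : rkhs R X).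
Local Notation C := R[i].
Local Notation "<[ u , v ]>" := (dot H u v).
Implicit Types (u v w f g : H).

Lemma dotDl u v w : <[u + v, w]> = <[u, w]> + <[v, w]>.
Proof. by rewrite linearDl. Qed.
Lemma dotDr u v w : <[w, u + v]> = <[w, u]> + <[w, v]>.
Proof. by rewrite linearDr. Qed.
Lemma dotZl c u v : <[c *: u, v]> = c * <[u, v]>.
Proof. by rewrite linearZl_LR. Qed.
Lemma dotZr c u v : <[u, c *: v]> = c^* * <[u, v]>.
Proof. by rewrite linearZr_LR. Qed.
Lemma dotC u v : <[u, v]> = <[v, u]>^*.
Proof. by rewrite hermC expr0 mul1r. Qed.
Lemma dotNl u v : <[- u, v]> = - <[u, v]>.
Proof. by rewrite linearNl. Qed.
Lemma dotNr u v : <[u, - v]> = - <[u, v]>.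
Proof. by rewrite linearNr. Qed.
Lemma dot0l u : <[0, u]> = 0. Proof. by rewrite linear0l. Qed.
Lemma dot0r u : <[u, 0]> = 0. Proof. by rewrite linear0r. Qed.
Lemma dot_suml (I : Type) (r : seq I) (P : pred I) (F : I -> H) u :
  <[\sum_(i <- r | P i) F i, u]> = \sum_(i <- r | P i) <[F i, u]>.
Proof. by rewrite linear_sumlz. Qed.
Lemma dot_sumr (I : Type) (r : seq I) (P : pred I) (F : I -> H) u :
  <[u, \sum_(i <- r | P i) F i]> = \sum_(i <- r | P i) <[u, F i]>.
Proof. by rewrite linear_sumr. Qed.
Lemma dot_ge0 u : 0 <= <[u, u]>. Proof. exact: dnorm_ge0. Qed.
Lemma dotJ u : <[u, u]>^* = <[u, u]>. Proof. exact/nneg_conj/dot_ge0. Qed.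

Lemma dot_kelt f x : <[f, kelt H x]> = ev H f x.
Proof. exact: kelt_repro. Qed.

Lemma kernel_dot x y : Defs.kernel H x y = <[kelt H y, kelt H x]>.
Proof. by rewrite dot_kelt. Qed.

Lemma kernelJ x y : (Defs.kernel H x y)^* = Defs.kernel H y x.
Proof. by rewrite !kernel_dot -dotC. Qed.

Lemma evD f g x : ev H (f + g) x = ev H f x + ev H g x.
Proof. by rewrite -!dot_kelt dotDl. Qed.
Lemma evN f x : ev H (- f) x = - ev H f x.
Proof. by rewrite -!dot_kelt dotNl. Qed.
Lemma evZ c f x : ev H (c *: f) x = c * ev H f x.
Proof. by rewrite -!dot_kelt dotZl. Qed.
Lemma ev_sum (I : Type) (r : seq I) (P : pred I) (F : I -> H) x :
  ev H (\sum_(i <- r | P i) F i) x = \sum_(i <- r | P i) ev H (F i) x.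
Proof. by rewrite -!dot_kelt dot_suml; apply: eq_bigr => i _; rewrite dot_kelt. Qed.

Lemma ev_ext f g : (forall x, ev H f x = ev H g x) -> f = g.
Proof. by move=> fg; apply: (@ev_inj _ _ H); apply/funext. Qed.

Lemma cauchy_schwarz u v : `|<[u, v]>| ^+ 2 <= <[u, u]> * <[v, v]>.
Proof.
have [->|v0] := eqVneq v 0; first by rewrite !dot0r normr0 mulr0 expr0n.
have vv : 0 < <[v, v]> by rewrite dnorm_gt0.
rewrite -subr_ge0 normCK.
have := mulr_ge0 (ltW vv) (dot_ge0 (u - (<[u, v]> / <[v, v]>) *: v)).
congr (0 <= _).
rewrite !(dotDl, dotDr, dotNl, dotNr, dotZl, dotZr) rmorphM fmorphV /= dotJ.
by rewrite (dotC v u); field; rewrite gt_eqF.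
Qed.

Lemma norm_dot_le u v : `|<[u, v]>| <= `|u| * `|v|.
Proof.
rewrite -(@ler_pXn2r _ 2) ?nnegrE ?mulr_ge0 //.
by rewrite exprMn !dot_norm cauchy_schwarz.
Qed.

Section Continuity.
Context {T : Type} {F : set_system T} {FF : ProperFilter F}.

Lemma cvg_dotl (f : T -> H) g w :
  f @ F --> g -> limC (F := F) (fun t => <[f t, w]>) <[g, w]>.
Proof.
move=> /cvgrPdist_lt fg; apply/limCP => e e0.
have w0 : 0 < `|w| + 1 by rewrite ltr_wpDl.
have := fg _ (divr_gt0 e0 w0); apply: filterS => t ht.
rewrite -dotNl -dotDl; apply: le_lt_trans (norm_dot_le _ _) _.
rewrite ltr_pdivlMr // in ht; apply: le_lt_trans ht.
by rewrite ler_wpM2l // lerDl.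
Qed.

End Continuity.
End HilbertSpace.

(** * Riesz representation *)

Section SquaredNorm.
Variables (R : realType) (X : Type) (H : rkhs R X).
Local Notation C := R[i].
Local Notation "<[ u , v ]>" := (dot H u v).

Lemma limC_natSinv : limC (F := \oo) (fun n => n.+1%:R^-1 : C) 0.
Proof.
apply/limCP => e e0.
have eR := ge0_ReE (ltW e0).
have eR0 : 0 < complex.Re e by move: e0; rewrite {1}eR ltcR.
have [N _ hN] := near_infty_natSinv_lt (PosNum eR0).
exists N => // n /= /hN /=; rewrite sub0r normrN ger0_norm // eR.
by rewrite -(rmorph_nat (real_complex R)) -fmorphV ltcR.
Qed.

Lemma limC_dist (T : Type) (F : set_system T) (FF : ProperFilter F)
    (v : T -> H) (g : H) :
  v @ F --> g -> limC (F := F) (fun t => <[v t - g, v t - g]>) 0.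
Proof.
move=> /cvgrPdist_lt vg.
have h : limC (F := F) (fun t => `|v t - g|) 0.
  by apply/limCP => e /vg; apply: filterS => t; rewrite sub0r normrN normr_id distrC.
rewrite -[X in limC _ X](mulr0 0); apply: (near_limC _ (limCM h h)); apply: nearW => t.
by rewrite -expr2 dot_norm.
Qed.

Lemma cauchy_dot_cvg (v : nat -> H) :
  (forall e : R, 0 < e -> exists N, forall n, (N <= n)%N ->
     <[v n - v N, v n - v N]> < e%:C) -> exists g : H, v @ \oo --> g.
Proof.
move=> vC; suff : cvg (v @ \oo) by move=> h; exists (lim (v @ \oo)).
apply: cauchy_cvg; apply: cauchy_exP => e e0.
have eR := ge0_ReE (ltW e0).
have eR0 : 0 < complex.Re e by move: e0; rewrite {1}eR ltcR.
have [N hN] := vC _ (exprn_gt0 2 eR0).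
exists (v N); exists N => // n /= /hN; rewrite -dot_norm rmorphXn /= -eR.
by rewrite ltr_pXn2r ?nnegrE ?normr_ge0 ?ltW // -ball_normE /= distrC.
Qed.

Variables (Y : Type) (I : finType).
Implicit Types (s t : seq (C * Y)) (e : Y -> I -> H).

Definition comb e s i := \sum_(p <- s) p.1 *: e p.2 i.

Lemma quadform_gram e s :
  quadform (fun x y => \sum_i <[e y i, e x i]>) s =
  \sum_i <[comb e s i, comb e s i]>.
Proof.
rewrite /quadform /comb; under [RHS]eq_bigr do rewrite dot_sumr.
rewrite [RHS]exchange_big; apply: eq_bigr => p _.
under [RHS]eq_bigr do rewrite dot_suml.
rewrite [RHS]exchange_big; apply: eq_bigr => q _.
by rewrite mulr_sumr; apply: eq_bigr => i _; rewrite dotZl dotZr; ring.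
Qed.

Lemma psd_gram e : psd (fun x y => \sum_i <[e y i, e x i]>).
Proof. by move=> s; rewrite quadform_gram sumr_ge0 // => i _; exact: dot_ge0. Qed.


(** Riesz representation.  The hypothesis says that the functional sending the
    formal combination [s] to [\sum p.1 * (h p.2)^*] is bounded by [B] for the
    norm of [comb e s].  It makes the functional [J] below bounded from below;
    by the parallelogram law a minimising sequence is a Cauchy sequence, and its
    limit [g] represents the functional.  The minimising sequence also exhibits
    [g] as a limit of combinations of the [e x]. *)
Theorem range_criterion e (h : Y -> C) (B : C) : 0 <= B ->
  psd (fun x y => B * (\sum_i <[e y i, e x i]>) - h x * (h y)^*) ->
  exists2 g : I -> H,
    (forall x, \sum_i <[g i, e x i]> = h x) /\ \sum_i <[g i, g i]> <= B &
    exists s : nat -> seq (C * Y), forall i, comb e (s n) i @[n --> \oo] --> g i.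
Proof.
move=> B0 hB.
pose Q s := \sum_i <[comb e s i, comb e s i]>.
pose l s := \sum_(p <- s) p.1 * (h p.2)^*.
have Q0 s : 0 <= Q s by apply: sumr_ge0 => i _; exact: dot_ge0.
have lQ s : `|l s| ^+ 2 <= B * Q s.
  rewrite -subr_ge0; have := hB s; congr (0 <= _).
  rewrite /Q -quadform_gram /quadform normCK [l s * _]mulrC /l rmorph_sum /=.
  rewrite mulr_sumr mulr_suml -sumrB.
  under [RHS]eq_bigr do rewrite 2!mulr_sumr -sumrB.
  apply: eq_bigr => p _; apply: eq_bigr => q _.
  by rewrite rmorphM /= conjCK; ring.
pose J s := Q s - (l s + (l s)^*).
have Jreal s : J s = (complex.Re (J s))%:C.
  apply/esym/RRe_real/CrealP.
  by rewrite rmorphB rmorphD /= conjCK (nneg_conj (Q0 s)) [_ + l s]addrC.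
have JB s : - B <= J s.
  (* Arithmetic-geometric mean inequality: [4 * (B * Q s) <= (Q s + B) ^+ 2]. *)
  have h2 : `|l s + (l s)^*| <= Q s + B.
    rewrite -(@ler_pXn2r _ 2) ?nnegrE ?addr_ge0 //.
    apply: (@le_trans _ _ (4 * (B * Q s))).
      apply: (@le_trans _ _ ((`|l s| + `|l s|) ^+ 2)).
        rewrite ler_pXn2r ?nnegrE ?addr_ge0 // (le_trans (ler_normD _ _)) //.
        by rewrite norm_conjC.
      by rewrite -mulr2n exprMn_n -mulr_natl ler_wpM2l.
    rewrite -subr_ge0 (_ : _ - _ = (Q s - B) ^+ 2); last by ring.
    by rewrite real_exprn_even_ge0 // realB ?ger0_real.
  have h3 : l s + (l s)^* \is Num.real by apply/CrealP; rewrite rmorphD /= conjCK addrC.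
  rewrite /J lerBrDr addrC lerBlDr; exact: le_trans (real_ler_norm h3) h2.
pose E : set R := [set complex.Re (J s) | s in setT].
have Einf : has_inf E.
  split; first by exists (complex.Re (J [::])), [::].
  exists (complex.Re (- B)) => _ [s _ <-].
  by have := JB s; rewrite lecE => /andP[].
have Emin s : (inf E)%:C <= J s.
  by rewrite Jreal lecR; apply: ge_inf; [case: Einf|exists s].
have /choice[s hs] : forall n : nat, exists s, J s < (inf E)%:C + (n.+1%:R^-1)%:C.
  move=> n; have [|x [s _ <-] hs] := @inf_adherent _ E n.+1%:R^-1 _ Einf.
    by rewrite invr_gt0.
  by exists s; rewrite Jreal -rmorphD ltcR.
have combD a b i : comb e (a ++ b) i = comb e a i + comb e b i.
  by rewrite /comb big_cat.
have lD a b : l (a ++ b) = l a + l b by rewrite /l big_cat.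
pose sc (c : C) (a : seq (C * Y)) := [seq (c * p.1, p.2) | p <- a].
have combZ c a i : comb e (sc c a) i = c *: comb e a i.
  rewrite /comb /sc big_map scaler_sumr; apply: eq_bigr => p _.
  by rewrite scalerA.
have lZ c a : l (sc c a) = c * l a.
  by rewrite /l /sc big_map mulr_sumr; apply: eq_bigr => p _; rewrite mulrA.
have half : (2^-1 : C)^* = 2^-1 by rewrite fmorphV /= rmorph_nat.
have para a b : Q (a ++ sc (-1) b) =
    2 * (J a + J b - 2 * J (sc 2^-1 a ++ sc 2^-1 b)).
  have -> : J a + J b - 2 * J (sc 2^-1 a ++ sc 2^-1 b) =
      Q a + Q b - 2 * Q (sc 2^-1 a ++ sc 2^-1 b).
    by rewrite /J lD !lZ !rmorphD !rmorphM /= half; field.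
  rewrite /Q mulr_sumr -big_split -sumrB mulr_sumr; apply: eq_bigr => i _ /=.
  rewrite !combD !combZ !(dotDl, dotDr, dotZl, dotZr) half rmorphN rmorph1.
  by field.
have Qdiff n m : Q (s n ++ sc (-1) (s m)) <=
    2 * (n.+1%:R^-1 + m.+1%:R^-1).
  rewrite para ler_pM2l // ; set t := (_ ++ _).
  rewrite -subr_ge0.
  have -> : n.+1%:R^-1 + m.+1%:R^-1 - (J (s n) + J (s m) - 2 * J t) =
      ((inf E)%:C + (n.+1%:R^-1)%:C - J (s n)) +
      ((inf E)%:C + (m.+1%:R^-1)%:C - J (s m)) + 2 * (J t - (inf E)%:C).
    by rewrite !fmorphV !rmorph_nat; ring.
  apply: addr_ge0; last by rewrite mulr_ge0 ?subr_ge0.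
  by apply: addr_ge0; rewrite subr_ge0 ltW.
have /choice[g hg] : forall i, exists g : H, comb e (s n) i @[n --> \oo] --> g.
  move=> i; apply: cauchy_dot_cvg => eps eps0.
  have eps4 : 0 < eps / 4 by rewrite divr_gt0.
  have [N _ hN] := near_infty_natSinv_lt (PosNum eps4).
  exists N => n Nn; apply: (@le_lt_trans _ _ (Q (s n ++ sc (-1) (s N)))).
    rewrite /Q (bigD1 i) //= combD combZ scaleN1r lerDl.
    by apply: sumr_ge0 => j _; exact: dot_ge0.
  apply: le_lt_trans (Qdiff _ _) _.
  have := ltrD (hN n Nn) (hN N (leqnn N)).
  rewrite /= => hlt.
  have cst k : (k.+1%:R^-1 : C) = (k.+1%:R^-1)%:C by rewrite fmorphV rmorph_nat.
  have two : (2 : C) = (2 : R)%:C by rewrite rmorph_nat.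
  rewrite !cst two -rmorphD -rmorphM ltcR mulrC -ltr_pdivlMr //.
  by apply: lt_le_trans hlt _; lra.
pose D v x := \sum_i <[v i, e x i]>.
have limD x : limC (F := \oo) (fun n => D (comb e (s n)) x) (D g x).
  by apply: limC_sum => i; exact: cvg_dotl.
have Dg x : D g x = h x.
  set dl := D g x - h x; pose Ex := \sum_i <[e x i, e x i]>.
  have Ex0 : 0 <= Ex by apply: sumr_ge0 => i _; exact: dot_ge0.
  (* Moving from the minimiser in the direction [c *: e x] cannot decrease [J]. *)
  have key c : 0 <= c * c^* * Ex + (c^* * dl + c * dl^*).
    apply: (@limC_ge0 _ _ \oo _ (fun n => c * c^* * Ex +
       (c^* * (D (comb e (s n)) x - h x) +
        c * (D (comb e (s n)) x - h x)^*) + n.+1%:R^-1)); last first.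
      rewrite -[X in limC _ X]addr0; apply: limCD; last exact: limC_natSinv.
      apply: limCD; first exact: limC_cst.
      have h1 : limC (F := \oo) (fun n => D (comb e (s n)) x - h x) dl.
        by apply: limCD => //; exact: limC_cst.
      by apply: limCD; [exact: (limCZ h1)|exact: (limCZ (limCJ h1))].
    apply: nearW => n; have hn := hs n; have := Emin (s n ++ [:: (c, x)]).
    have comb1 i : comb e [:: (c, x)] i = c *: e x i by rewrite /comb big_seq1.
    have l1 : l [:: (c, x)] = c * (h x)^* by rewrite /l big_seq1.
    have Q1 : Q (s n ++ [:: (c, x)]) = Q (s n) + c * c^* * Ex +
        (c^* * D (comb e (s n)) x + c * (D (comb e (s n)) x)^*).
      rewrite /D rmorph_sum /= /Q /Ex !mulr_sumr -!big_split /=.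
      apply: eq_bigr => i _; rewrite combD comb1 !(dotDl, dotDr, dotZl, dotZr).
      by rewrite [dot H (e x i) (comb e _ i)]dotC; ring.
    rewrite -subr_ge0 => hE; rewrite -subr_gt0 in hn.
    have := addr_ge0 hE (ltW hn); congr (0 <= _).
    rewrite /J Q1 lD l1 !(rmorphD, rmorphM, rmorphB) /= conjCK fmorphV rmorph_nat.
    by ring.
  have := key (- (dl / (Ex + 1))).
  have E1 : 0 < Ex + 1 by rewrite ltr_wpDl.
  have E1J : (Ex + 1)^* = Ex + 1 by apply/nneg_conj/ltW.
  rewrite rmorphN rmorphM fmorphV /= E1J.
  set w := _ + _; have -> : w = - (dl * dl^*) * ((Ex + 2) / (Ex + 1) ^+ 2).
    by rewrite /w; field; rewrite gt_eqF.
  rewrite mulNr oppr_ge0 pmulr_lle0 ?divr_gt0 ?exprn_gt0 ?ltr_wpDl // => hd.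
  have : dl * dl^* == 0 by rewrite eq_le hd mul_conjC_ge0.
  by rewrite mul_conjC_eq0 subr_eq0 => /eqP.
exists g; last by exists s.
split; first by move=> x; exact: Dg.
have lg n : l (s n) = \sum_i <[comb e (s n) i, g i]>.
  rewrite /l /comb; under [RHS]eq_bigr do rewrite dot_suml.
  rewrite exchange_big; apply: eq_bigr => p _.
  rewrite -Dg /D rmorph_sum /= mulr_sumr; apply: eq_bigr => i _.
  by rewrite dotZl [in RHS]dotC.
(* Completing the square, the lower bound on [J] becomes the norm bound on [g]. *)
have Jg n : J (s n) = \sum_i <[comb e (s n) i - g i, comb e (s n) i - g i]> -
    \sum_i <[g i, g i]>.
  rewrite /J lg rmorph_sum /= /Q -big_split -!sumrB; apply: eq_bigr => i _ /=.
  by rewrite !(dotDl, dotDr, dotNl, dotNr) -dotC; ring.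
rewrite -subr_ge0; apply: (@limC_ge0 _ _ \oo _ (fun n =>
    \sum_i <[comb e (s n) i - g i, comb e (s n) i - g i]> +
    (B - \sum_i <[g i, g i]>))).
  by apply: nearW => n; have := JB (s n); rewrite Jg -subr_ge0; congr (0 <= _); ring.
rewrite -[X in limC _ X]add0r; apply: limCD; last exact: limC_cst.
rewrite -[X in limC _ X](@big1_eq _ 0 +%R I (index_enum I) predT).
by apply: limC_sum => i; exact: limC_dist.
Qed.
End SquaredNorm.

(** * Finite Gram matrices *)

Section FiniteForms.
Variable R : realType.
Local Notation C := R[i].

Lemma psd_comp (X Y : Type) (f : Y -> X) (L : X -> X -> C) :
  psd L -> psd (fun x y => L (f x) (f y)).
Proof.
move=> Lp s; have := Lp [seq (p.1, f p.2) | p <- s].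
by rewrite /quadform big_map; under eq_bigr do rewrite big_map.
Qed.

Lemma psd_finite (X : Type) (L : X -> X -> C) :
  (forall n (z : 'I_n -> X), psd (fun i j => L (z i) (z j))) -> psd L.
Proof.
move=> h s; pose z (i : 'I_(size s)) := (tnth (in_tuple s) i).2.
have := h _ z [seq ((tnth (in_tuple s) i).1, i) | i <- index_enum 'I_(size s)].
congr (0 <= _); rewrite /quadform big_map [RHS]big_tnth; apply: eq_bigr => i _.
by rewrite big_map [RHS]big_tnth.
Qed.

Lemma psd_form (I : finType) (L : I -> I -> C) (v : I -> C) : psd L ->
  0 <= \sum_i \sum_j (v i)^* * v j * L i j.
Proof.
move/(_ [seq (v i, i) | i <- index_enum I]).
congr (0 <= _); rewrite /quadform big_map; apply: eq_bigr => i _.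
by rewrite big_map.
Qed.

Lemma psd_sum_rank1 (X : Type) (I : finType) (u : X -> I -> C) :
  psd (fun x y => \sum_i u x i * (u y i)^*).
Proof. by apply: psd_sum => i; exact: psd_rank1. Qed.

Local Open Scope sesquilinear_scope.

(** By the spectral theorem; the columns of [b] are eigenvectors scaled by the
    square roots of the eigenvalues. *)
Lemma gram_factor n (L : 'I_n -> 'I_n -> C) : psd L ->
  exists b : 'I_n -> 'I_n -> C, forall i j, L i j = \sum_k b i k * (b j k)^*.
Proof.
move=> Lp; pose M : 'M[C]_n := \matrix_(i, j) L i j.
have Mn : M \is normalmx.
  apply: hermitian_normalmx; apply/is_hermitianmxP; rewrite expr0 scale1r.
  by apply/matrixP => i j; rewrite !mxE; exact: psd_herm.
have := orthomx_spectralP Mn; set P := spectralmx M; set D := spectral_diag M.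
have Pu : P \is unitarymx by exact: spectral_unitarymx.
have PPt : P *m P ^t* = 1%:M by exact/unitarymxP.
rewrite invmx_unitary // => Meq.
have D0 k : 0 <= D 0 k.
  have := psd_form (fun j => (P k j)^*) Lp; congr (0 <= _).
  have <- : (P *m M *m P^t*) k k = D 0 k.
    rewrite Meq !mulmxA PPt mul1mx -mulmxA PPt mulmx1.
    by rewrite mxE eqxx mulr1n.
  rewrite -mulmxA mxE; apply: eq_bigr => i _; rewrite conjCK mxE mulr_sumr.
  by apply: eq_bigr => j _; rewrite !mxE; ring.
exists (fun i k => (P k i)^* * sqrtC (D 0 k)) => i j.
have <- : M i j = L i j by rewrite mxE.
rewrite Meq -mulmxA mxE; apply: eq_bigr => k _.
rewrite mul_diag_mx !mxE rmorphM /= conjCK.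
rewrite (nneg_conj (_ : 0 <= sqrtC _)) ?sqrtC_ge0 //.
by rewrite -{1}(sqrtCK (D 0 k)); ring.
Qed.

Lemma posemidef_mxblock n r (B : 'I_n -> 'I_n -> 'M[C]_r) :
  (forall u : 'I_n -> 'I_r -> C,
    0 <= \sum_i \sum_j \sum_a \sum_b (u i a)^* * u j b * B i j a b) ->
  posemidef (\mxblock_(i < n, j < n) B i j).
Proof.
move=> hB v; rewrite -(submxcolK v) tr_mxcol.
have -> : map_mx Num.conj (\mxrow_i (submxcol v i)^T) = \mxrow_i ((submxcol v i) ^t Num.conj).
  by apply/matrixP => a b; rewrite !mxE.
rewrite mul_mxrow_mxblock mul_mxrow_mxcol summxE.
have := hB (fun i a => submxcol v i a 0); congr (0 <= _).
rewrite exchange_big; apply: eq_bigr => j _ /=.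
rewrite mulmx_suml summxE; apply: eq_bigr => i _.
rewrite [RHS]mxE [LHS]exchange_big; apply: eq_bigr => b _ /=.
rewrite [X in X * _]mxE mulr_suml; apply: eq_bigr => a _.
by rewrite [X in _ = X * _ * _]mxE [X in _ = X^* * _ * _]mxE; ring.
Qed.
End FiniteForms.

(** * The complete Pick property and the reciprocal kernel *)

Section CompletePick.
Variables (R : realType) (X : Type) (H : rkhs R X).
Local Notation C := R[i].
Local Notation K := (Defs.kernel H).
Local Notation "<[ u , v ]>" := (dot H u v).
Hypothesis K0 : forall x y, K x y != 0.

Lemma psd_kernel : psd K.
Proof.
apply: eq_psd (@psd_gram _ _ H X unit (fun x _ => kelt H x)) => x y.
by rewrite (big_pred1 tt) ?kernel_dot // => -[].
Qed.

Lemma kernel_gt0 x : 0 < K x x.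
Proof. by rewrite lt_def K0 psd_diag //; exact: psd_kernel. Qed.

(** The kernel [1 - 1/K] after rescaling [K] so that it equals 1 whenever one
    argument is the base point [w]. *)
Definition reciprocal w x y : C := 1 - K x w * K w y / (K w w * K x y).

(** Extending a positive kernel by zero keeps it positive. *)
Lemma psd_lift n (L : 'I_n.+1 -> 'I_n.+1 -> C) :
  (forall i, L ord_max i = 0) -> (forall i, L i ord_max = 0) ->
  psd (fun i j => L (lift ord_max i) (lift ord_max j)) -> psd L.
Proof.
move=> L0l L0r hL s.
pose t := pmap (fun p : C * 'I_n.+1 =>
  omap (fun j => (p.1, j)) (unlift ord_max p.2)) s.
have big_t (F : C -> 'I_n.+1 -> C) : (forall c, F c ord_max = 0) ->
    \sum_(p <- s) F p.1 p.2 = \sum_(p <- t) F p.1 (lift ord_max p.2).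
  move=> F0; rewrite /t; elim: (s) => [|[c i] r IH]; first by rewrite !big_nil.
  rewrite big_cons IH /=; case: unliftP => [j ->|->] /=; first by rewrite big_cons.
  by rewrite F0 add0r.
have := hL t; congr (0 <= _); rewrite /quadform.
rewrite (big_t (fun c i => \sum_(q <- s) c^* * q.1 * L i q.2)); last first.
  by move=> c; rewrite big1 // => q _; rewrite L0l mulr0.
apply: eq_bigr => p _.
rewrite (big_t (fun c i => p.1^* * c * L (lift ord_max p.2) i)) // => c.
by rewrite L0r mulr0.
Qed.

(** Suppose that the reciprocal kernel based at [v] is the Gram matrix of vectors
    [b i].  Then [K (z i) (z j) * (1 - \sum_k b i k * (b j k)^* )] has rank one,
    hence is positive, and the complete Pick property gives a contractive
    multiplier [Phi] whose first row at [z i] is [b i].  As [Phi] maps functions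
    vanishing at [w] to functions vanishing at [w], the same positivity holds
    with [K] replaced by the kernel of the subspace of those functions, which is
    [K * reciprocal w]; dividing by the rank one factor leaves
    [reciprocal w]. *)
Lemma pick_step n (z : 'I_n.+1 -> X) (b : 'I_n.+1 -> 'I_n.+1 -> C) v w :
  complete_nevanlinna_pick H ->
  (forall i j, reciprocal v (z i) (z j) = \sum_k b i k * (b j k)^*) ->
  psd (fun i j => reciprocal w (z i) (z j)).
Proof.
move=> cnp hb.
pose Lam i : 'M[C]_n.+1 := \matrix_(a, k) (if a == ord0 then b i k else 0).
have [|Phi [PhiM Phile] Phiz] := cnp _ _ (ltn0Sn n) (ltn0Sn n) z Lam.
  apply: posemidef_mxblock => u.
  pose T (a : 'I_n.+1) x y := if a == ord0 then (K v v)^-1 * (K x v * (K y v)^*) else K x y.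
  have Tp a : psd (T a).
    rewrite /T; case: eqP => _; last exact: psd_kernel.
    by apply: psdZ; [rewrite invr_ge0 ltW ?kernel_gt0|exact: psd_rank1].
  have : 0 <= \sum_a \sum_i \sum_j (u i a)^* * u j a * T a (z i) (z j).
    by apply: sumr_ge0 => a _; exact: psd_form (psd_comp z (Tp a)).
  congr (0 <= _); rewrite exchange_big; apply: eq_bigr => i _ /=.
  rewrite exchange_big; apply: eq_bigr => j _ /=; apply: eq_bigr => a _.
  rewrite (bigD1 a) //= [X in _ = _ + X]big1 ?addr0.
    congr (_ * _); rewrite /T !mxE eqxx mulr1n.
    under eq_bigr do rewrite !mxE.
    case: eqP => [_|_]; last by rewrite big1 ?subr0 ?mulr1 // => k _; rewrite mul0r.
    rewrite -hb /reciprocal kernelJ; field; by rewrite !K0.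
  move=> a' /negPf aa'; rewrite !mxE [a == a']eq_sym aa' mulr0n sub0r.
  rewrite big1 ?oppr0 ?mulr0 // => k _; rewrite !mxE.
  have [a0|_] := eqVneq a ord0; last by rewrite mul0r.
  have [a'0|_] := eqVneq a' ord0; last by rewrite conjC0 mulr0.
  by rewrite a0 a'0 eqxx in aa'.
move=> s.
have /choice[c hc] : forall i, exists c : C, c * (K (z i) v)^* = 1.
  by move=> i; exists ((K (z i) v)^*)^-1; rewrite mulVf // conjC_eq0.
(* [k' i] reproduces the value at [z i] on functions vanishing at [w]. *)
pose k' i := kelt H (z i) - (K w (z i) / K w w) *: kelt H w.
pose cf (p : C * 'I_n.+1) := p.1 * c p.2.
pose x := \sum_(p <- s) cf p *: k' p.2.
pose y l := \sum_(p <- s) (cf p * (b p.2 l)^*) *: k' p.2.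
have k'w i : ev H (k' i) w = 0.
  rewrite evD evN evZ -/(K w (z i)) -/(K w w) divfK ?subrr //.
have yw l : ev H (y l) w = 0.
  by rewrite ev_sum big1 // => p _; rewrite evZ k'w mulr0.
have dotk' f i : ev H f w = 0 -> <[f, k' i]> = ev H f (z i).
  by move=> fw; rewrite dotDr dotNr dotZr !dot_kelt fw mulr0 subr0.
have /choice[g hg] : forall i, exists g : H, forall p,
    ev H g p = \sum_j Phi p i j * ev H (y j) p.
  move=> i; have /choice[g hg] : forall j, exists g : H, forall p,
      ev H g p = Phi p i j * ev H (y j) p by move=> j; exact: PhiM.
  exists (\sum_j g j) => p; rewrite ev_sum; exact: eq_bigr.
have gy : \sum_i <[g i, g i]> <= \sum_i <[y i, y i]>.
  by have := Phile y g hg; under eq_bigr do rewrite dot_norm;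
     under [X in _ <= X]eq_bigr do rewrite dot_norm.
have g0w : ev H (g ord0) w = 0 by rewrite hg big1 // => i _; rewrite yw mulr0.
(* [x] is paired with [Phi y] so that duality exhibits the adjoint of [Phi]
   on the kernel functions [k']. *)
have gx : <[g ord0, x]> = \sum_i <[y i, y i]>.
  under [RHS]eq_bigr do rewrite {2}/y dot_sumr.
  rewrite exchange_big /x dot_sumr; apply: eq_bigr => p _.
  rewrite dotZr dotk' // hg mulr_sumr; apply: eq_bigr => j _.
  rewrite dotZr dotk' // Phiz mxE eqxx [(cf p * _)^*]rmorphM /= conjCK; ring.
have Y0 : 0 <= \sum_i <[y i, y i]> by apply: sumr_ge0 => i _; exact: dot_ge0.
have yx : \sum_i <[y i, y i]> <= <[x, x]>.
  have [->|Yn0] := eqVneq (\sum_i <[y i, y i]>) 0; first exact: dot_ge0.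
  have Yp : 0 < \sum_i <[y i, y i]> by rewrite lt_def Yn0.
  rewrite -(ler_pM2l Yp) -expr2.
  have := cauchy_schwarz (g ord0) x; rewrite gx (ger0_norm Y0) => /le_trans; apply.
  rewrite ler_wpM2r ?dot_ge0 // (le_trans _ gy) // (bigD1 ord0) //= lerDl.
  by apply: sumr_ge0 => i _; exact: dot_ge0.
rewrite -subr_ge0 in yx; have := mulr_ge0 (ltW (kernel_gt0 v)) yx.
congr (0 <= _).
have dots (u : C * 'I_n.+1 -> H) : <[\sum_(p <- s) u p, \sum_(p <- s) u p]> =
    \sum_(q <- s) \sum_(p <- s) <[u q, u p]>.
  by rewrite dot_suml; apply: eq_bigr => q _; rewrite dot_sumr.
rewrite [<[x, x]>]dots; under [X in _ - X]eq_bigr do rewrite dots.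
rewrite [X in _ - X]exchange_big -sumrB mulr_sumr [RHS]exchange_big; apply: eq_bigr => q _ /=.
rewrite [X in _ - X]exchange_big -sumrB mulr_sumr; apply: eq_bigr => p _ /=.
have dkk : <[k' q.2, k' p.2]> = K (z p.2) (z q.2) * reciprocal w (z p.2) (z q.2).
  rewrite dotk' // evD evN evZ /reciprocal -/(K (z p.2) (z q.2)) -/(K (z p.2) w).
  by field; rewrite !K0.
under eq_bigr do rewrite dotZl dotZr dkk.
rewrite dotZl dotZr dkk.
have -> : \sum_i (cf q * (b q.2 i)^*) * ((cf p * (b p.2 i)^*)^* *
    (K (z p.2) (z q.2) * reciprocal w (z p.2) (z q.2))) =
    (cf q * (cf p)^* * (K (z p.2) (z q.2) * reciprocal w (z p.2) (z q.2))) *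
    reciprocal v (z p.2) (z q.2).
  rewrite hb mulr_sumr; apply: eq_bigr => i _.
  by rewrite [(cf p * _)^*]rmorphM /= conjCK; ring.
have cp : (c p.2)^* * K (z p.2) v = 1.
  by rewrite -(conjCK (K _ _)) -rmorphM hc rmorph1.
have cq : c q.2 * K v (z q.2) = 1 by rewrite -kernelJ hc.
have rv : K v v * K (z p.2) (z q.2) * (1 - reciprocal v (z p.2) (z q.2)) =
    K (z p.2) v * K v (z q.2).
  by rewrite /reciprocal; field; rewrite !K0.
rewrite /cf rmorphM /=.
transitivity ((q.1 * p.1^*) * reciprocal w (z p.2) (z q.2) * ((c p.2)^* * c q.2) *
  (K v v * K (z p.2) (z q.2) * (1 - reciprocal v (z p.2) (z q.2)))); first by ring.
rewrite rv.
transitivity ((q.1 * p.1^*) * reciprocal w (z p.2) (z q.2) *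
  ((c p.2)^* * K (z p.2) v) * (c q.2 * K v (z q.2))); first by ring.
by rewrite cp cq; ring.
Qed.

(** Induction on the number of points: with one of the points as the base, the
    reciprocal kernel vanishes along the row and the column of that point, so
    the induction hypothesis makes it positive, hence a Gram matrix, on all the
    points; [pick_step] then moves the base point to [w]. *)
Theorem psd_reciprocal w : complete_nevanlinna_pick H -> psd (reciprocal w).
Proof.
move=> cnp; apply: psd_finite => n; elim: n w => [|n IH] w z.
  move=> s; case: s => [|[c []] //]; by rewrite /quadform big_nil.
have h : psd (fun i j => reciprocal (z ord_max) (z i) (z j)).
  apply: psd_lift => [i|i|]; last exact: IH.
    by rewrite /reciprocal divff ?subrr ?mulf_neq0.
  by rewrite /reciprocal [K (z i) _ * _]mulrC divff ?subrr ?mulf_neq0.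
have [b hb] := gram_factor h.
exact: pick_step hb.
Qed.
End CompletePick.

(** * Factorisation on a finite set *)

Section Adjoint.
Variable R : realType.
Local Notation C := R[i].

Definition adj m n (A : 'M[C]_(m, n)) : 'M[C]_(n, m) := map_mx Num.conj A^T.

Lemma adjM m n p (A : 'M[C]_(m, n)) (B : 'M[C]_(n, p)) :
  adj (A *m B) = adj B *m adj A.
Proof. by rewrite /adj trmx_mul map_mxM. Qed.
Lemma adjK m n (A : 'M[C]_(m, n)) : adj (adj A) = A.
Proof. by apply/matrixP => i j; rewrite !mxE conjCK. Qed.
Lemma adjB m n (A B : 'M[C]_(m, n)) : adj (A - B) = adj A - adj B.
Proof. by apply/matrixP => i j; rewrite !mxE rmorphB. Qed.
Lemma adj1 n : adj (1%:M : 'M[C]_n) = 1%:M.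
Proof. by apply/matrixP => i j; rewrite !mxE eq_sym rmorph_nat. Qed.
Lemma adj_row_mx m n p (A : 'M[C]_(m, n)) (B : 'M[C]_(m, p)) :
  adj (row_mx A B) = col_mx (adj A) (adj B).
Proof. by rewrite /adj tr_row_mx map_col_mx. Qed.

Lemma mul_adjE m n p (A : 'M[C]_(m, n)) (B : 'M[C]_(p, n)) i j :
  (A *m adj B) i j = \sum_k A i k * (B j k)^*.
Proof. by rewrite mxE; apply: eq_bigr => k _; rewrite !mxE. Qed.

Lemma mul_adj_ge0 m n (A : 'M[C]_(m, n)) i : 0 <= (A *m adj A) i i.
Proof. by rewrite mul_adjE sumr_ge0 // => k _; rewrite mul_conjC_ge0. Qed.

Lemma mul_adj_eq0 m n (A : 'M[C]_(m, n)) : A *m adj A = 0 -> A = 0.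
Proof.
move=> /matrixP A0; apply/matrixP => i k; rewrite mxE.
have /eqP := A0 i i; rewrite mul_adjE mxE psumr_eq0; last first.
  by move=> j _; rewrite mul_conjC_ge0.
by move=> /allP/(_ k (mem_index_enum _)); rewrite implyTb mul_conjC_eq0 => /eqP.
Qed.

(** Rows with the same Gram matrix are related by a contraction.  The map is the
    partial isometry between the row spaces: for any generalised inverse of the
    Gram matrix the product [V *m adj V] is an orthogonal projection. *)
Lemma lurking_contraction n p q (A : 'M[C]_(n, p)) (B : 'M[C]_(n, q)) :
  A *m adj A = B *m adj B ->
  exists2 V : 'M[C]_(p, q), A *m V = B &
    exists W : 'M[C]_p, 1%:M - V *m adj V = W *m adj W.
Proof.
move=> AB; have [P PE] : exists P, P = A *m adj A by eexists.
have [N NE] : exists N, N = pinvmx P by eexists.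
have PNP : P *m N *m P = P by rewrite NE mulmxKpV.
have adjP : adj P = P by rewrite PE adjM adjK.
have PNsP : P *m adj N *m P = P.
  by have := congr1 (@adj _ _) PNP; rewrite adjM [adj (P *m N)]adjM adjP mulmxA.
pose V := adj A *m N *m B; exists V.
  apply/eqP; rewrite -subr_eq0; apply/eqP/mul_adj_eq0.
  have -> : A *m V - B = (P *m N - 1%:M) *m B.
    by rewrite /V !mulmxA -PE mulmxBl mul1mx.
  by rewrite adjM mulmxA -[_ *m B *m _]mulmxA -AB -PE mulmxBl PNP mul1mx subrr mul0mx.
have VV : V *m adj V = adj A *m N *m P *m adj N *m A.
  by rewrite /V !adjM adjK !mulmxA -[_ *m B *m adj B]mulmxA -AB -PE.
have VVJ : adj (V *m adj V) = V *m adj V by rewrite adjM adjK.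
exists (1%:M - V *m adj V); rewrite adjB adj1 VVJ.
rewrite mulmxBl mul1mx mulmxBr mulmx1.
suff -> : V *m adj V *m (V *m adj V) = V *m adj V by rewrite subrr subr0.
rewrite {3}VV {1}VV VV !mulmxA -[_ *m A *m adj A]mulmxA -PE.
rewrite -[_ *m P *m adj N *m P]mulmxA -[_ *m P *m (adj N *m P)]mulmxA [P *m (adj N *m P)]mulmxA PNsP.
by rewrite -[_ *m P *m N *m P]mulmxA -[_ *m P *m (N *m P)]mulmxA [P *m (N *m P)]mulmxA PNP.
Qed.

Lemma unitmx_noker n (A : 'M[C]_n) :
  (forall u : 'rV_n, u *m A = 0 -> u = 0) -> A \in unitmx.
Proof.
move=> h; rewrite -row_free_unit -kermx_eq0; apply/eqP/row_matrixP => i.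
by rewrite row0; apply: h; rewrite -row_mul mulmx_ker row0.
Qed.
End Adjoint.

Section FiniteLeech.
Variables (R : realType) (n d : nat).
Local Notation C := R[i].
Variables (K : 'I_n -> 'I_n -> C) (F : 'I_n -> 'I_d -> C) (phi : 'I_n -> C).
Hypothesis K0 : forall i j, K i j != 0.
Hypothesis Kp : psd K.
Hypothesis Krec : psd (fun i j => 1 - (K i j)^-1).
Hypothesis KF : psd (fun i j =>
  K i j * (\sum_l F i l * (F j l)^* - phi i * (phi j)^*)).

(** Lurking isometry.  Write [1 - 1/K] and the positive kernel [KF] as Gram
    matrices of [b] and [G0].  Their definitions rearrange to an equality of Gram
    matrices of the rows [(F i, b i (x) G i)] and [(phi i, G i)], so a contraction
    [V] maps the former to the latter.  Solving the resulting linear system for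
    [G i] leaves [F i *m Lam i = phi i], where [Lam] is the transfer function of
    the block decomposition of [V]. *)
Lemma finite_leech : exists2 Lam : 'I_n -> 'I_d -> C,
  forall i, \sum_l F i l * Lam i l = phi i &
  forall l, psd (fun i j => K i j * (1 - Lam i l * (Lam j l)^*)).
Proof.
have [b hb] := gram_factor Krec; have [G0 hG] := gram_factor KF.
pose q := #|{: 'I_n * 'I_n}|.
(* [G i *m Z i] is the tensor product of the rows [b i] and [G i]. *)
pose Z i : 'M[C]_(n, q) :=
  \matrix_(s, t) (b i (enum_val t).1 * (s == (enum_val t).2)%:R).
have ZZ i j : Z i *m adj (Z j) = (1 - (K i j)^-1)%:M.
  apply/matrixP => s s'; rewrite mul_adjE mxE hb.
  under eq_bigr do rewrite !mxE.
  rewrite (reindex (@enum_rank _)) /=; last by apply: onW_bij; exact: enum_rank_bij.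
  under eq_bigr do rewrite !enum_rankK.
  rewrite -(pair_bigA _ (fun k r => b i k * (s == r)%:R * (b j k * (s' == r)%:R)^*)) /=.
  rewrite -sumrMnl; apply: eq_bigr => k _.
  rewrite (bigD1 s) //= big1 ?addr0; last first.
    by move=> r /negPf rs; rewrite eq_sym rs mulr0 mul0r.
  rewrite eqxx mulr1 rmorphM /= rmorph_nat eq_sym.
  by rewrite mulrA mulr_natr.
pose G i : 'rV[C]_n := \row_k G0 i k.
pose f i : 'rV[C]_d := \row_l F i l.
pose A : 'M[C]_(n, d + q) := \matrix_i row_mx (f i) (G i *m Z i).
pose B : 'M[C]_(n, 1 + n) := \matrix_i row_mx (phi i)%:M (G i).
have AB : A *m adj A = B *m adj B.
  have mE m (u : 'I_n -> 'rV[C]_m) i k : (\matrix_i u i) i k = u i 0 k.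
    by rewrite mxE.
  have rr m p (u v : 'I_n -> 'rV[C]_m) (u' v' : 'I_n -> 'rV[C]_p) i j :
     ((\matrix_i row_mx (u i) (u' i)) *m adj (\matrix_i row_mx (v i) (v' i))) i j =
     (u i *m adj (v j)) 0 0 + (u' i *m adj (v' j)) 0 0.
    rewrite !mul_adjE big_split_ord; congr (_ + _); apply: eq_bigr => k _.
      by rewrite !mE !row_mxEl.
    by rewrite !mE !row_mxEr.
  apply/matrixP => i j; rewrite /A /B !rr.
  rewrite adjM mulmxA -[G i *m Z i *m _]mulmxA ZZ mul_mx_scalar -scalemxAl [X in _ + X = _]mxE.
  have -> : (G i *m adj (G j)) 0 0 = K i j * (\sum_l F i l * (F j l)^* - phi i * (phi j)^*).
    by rewrite mul_adjE hG; apply: eq_bigr => k _; rewrite !mxE.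
  have -> : (f i *m adj (f j)) 0 0 = \sum_l F i l * (F j l)^*.
    by rewrite mul_adjE; apply: eq_bigr => k _; rewrite !mxE.
  rewrite mul_adjE big_ord1 !mxE eqxx !mulr1n.
  by field; rewrite K0.
have [V AV [W VW]] := lurking_contraction AB.
pose A1 := ulsubmx V; pose B1 := ursubmx V; pose C1 := dlsubmx V; pose D1 := drsubmx V.
have row_contr (x : 'rV[C]_(d + q)) :
    (x *m V *m adj (x *m V)) 0 0 <= (x *m adj x) 0 0.
  rewrite -subr_ge0.
  have -> : (x *m adj x) 0 0 - (x *m V *m adj (x *m V)) 0 0 =
      (x *m W *m adj (x *m W)) 0 0.
    rewrite !adjM !mulmxA -[x *m W *m _]mulmxA -VW mulmxBr mulmx1 mulmxBl !mulmxA.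
    by rewrite [RHS]mxE [X in _ = _ + X]mxE.
  exact: mul_adj_ge0.
have D1_contr (y : 'rV[C]_q) : (y *m D1 *m adj (y *m D1)) 0 0 <= (y *m adj y) 0 0.
  have := row_contr (row_mx 0 y).
  rewrite -[V]submxK mul_row_block !mul0mx !add0r !adj_row_mx !mul_row_col.
  rewrite mul0mx add0r mxE; apply: le_trans; rewrite lerDr; exact: mul_adj_ge0.
have Kii i : 0 < K i i by rewrite lt_def K0 psd_diag.
(* [Z i] is a strict contraction since [1 - (K i i)^-1 < 1]. *)
have Sunit i : 1%:M - Z i *m D1 \in unitmx.
  apply: unitmx_noker => u /eqP; rewrite mulmxBr mulmx1 subr_eq0 mulmxA => /eqP uE.
  have := D1_contr (u *m Z i); rewrite -uE adjM mulmxA -[u *m Z i *m _]mulmxA ZZ.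
  rewrite mul_mx_scalar -scalemxAl [in X in _ <= X]mxE => hu.
  apply: mul_adj_eq0; apply/matrixP => a b'; rewrite !ord1 [RHS]mxE; apply/eqP.
  rewrite eq_le mul_adj_ge0 andbT.
  rewrite -subr_ge0 mulrBl mul1r addrAC subrr sub0r oppr_ge0 in hu.
  by rewrite pmulr_rle0 ?invr_gt0 in hu.
pose S i := invmx (1%:M - Z i *m D1).
have SE i : S i *m Z i *m D1 = S i - 1%:M.
  have := mulVmx (Sunit i); rewrite -/(S i) mulmxBr mulmx1 mulmxA => <-.
  by rewrite opprB addrC subrK.
pose Lam i : 'cV[C]_d := A1 + B1 *m S i *m Z i *m C1.
have rowA i : row i A *m V = row i B by rewrite -AV row_mul.
have rowE i : (f i *m A1 + G i *m Z i *m C1 = (phi i)%:M) *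
              (f i *m B1 + G i *m Z i *m D1 = G i).
  have := rowA i; rewrite /A /B !rowK -[V]submxK mul_row_block.
  by move=> /eq_row_mx[-> ->].
have GE i : G i = f i *m B1 *m S i.
  have : G i *m (1%:M - Z i *m D1) = f i *m B1.
    by rewrite mulmxBr mulmx1 mulmxA -{1}(rowE i).2 addrK.
  by move=> <-; rewrite mulmxK // Sunit.
exists (fun i l => Lam i l 0).
  move=> i; have : f i *m Lam i = (phi i)%:M.
    by rewrite /Lam mulmxDr !mulmxA -GE (rowE i).1.
  move=> /matrixP/(_ 0 0); rewrite !mxE eqxx mulr1n => <-.
  by apply: eq_bigr => l _; rewrite [f i 0 l]mxE.
(* [L i] is chosen so that [L i *m V] contains [Lam i] as its first block. *)
pose L i : 'M[C]_(d, d + q) := row_mx 1%:M (B1 *m S i *m Z i).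
have LV i : L i *m V = row_mx (Lam i) (B1 *m S i).
  rewrite /L -[V]submxK mul_row_block !mul1mx; congr row_mx.
  by rewrite -[_ *m Z i *m _]mulmxA -[B1 *m S i *m _]mulmxA [S i *m (_ *m _)]mulmxA SE mulmxBr mulmx1 addrC subrK.
have LL i j : L i *m adj (L j) =
    1%:M + (1 - (K i j)^-1) *: (B1 *m S i *m adj (B1 *m S j)).
  rewrite /L adj_row_mx mul_row_col mul1mx adj1 [adj (_ *m Z j)]adjM mulmxA.
  by rewrite -[_ *m Z i *m _]mulmxA ZZ mul_mx_scalar -scalemxAl.
have key i j l : K i j * (1 - Lam i l 0 * (Lam j l 0)^*) =
    (B1 *m S i *m adj (B1 *m S j)) l l +
    K i j * (L i *m W *m adj (L j *m W)) l l.
  have : L i *m W *m adj (L j *m W) = 1%:M - Lam i *m adj (Lam j) -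
     (K i j)^-1 *: (B1 *m S i *m adj (B1 *m S j)).
    rewrite adjM mulmxA -[L i *m W *m _]mulmxA -VW mulmxBr mulmx1 mulmxBl LL.
    rewrite !mulmxA -[_ *m adj V *m _]mulmxA -adjM !LV adj_row_mx mul_row_col.
    rewrite scalerBl scale1r.
    set x := Lam i *m _; set y := B1 *m _ *m _; set z := _ *: y.
    by apply/matrixP => a a'; rewrite !mxE; ring.
  move=> ->; rewrite [X in _ + K i j * X]mxE [X in _ + K i j * (X + _)]mxE.
  rewrite [X in _ + K i j * (_ + X)]mxE [X in _ + K i j * (_ + - X)]mxE.
  rewrite [X in _ + K i j * (X + _ + _)]mxE [X in _ + K i j * (_ + X + _)]mxE.
  rewrite eqxx mulr1n [X in _ + K i j * (_ - X + _)]mul_adjE big_ord1.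
  by field; rewrite K0.
move=> l; apply: (@eq_psd _ _ (fun i j =>
   (B1 *m S i *m adj (B1 *m S j)) l l + K i j * (L i *m W *m adj (L j *m W)) l l)).
  by move=> i j; rewrite key.
apply: psdD.
  apply: eq_psd (psd_sum_rank1 (fun i k => (B1 *m S i) l k)) => i j.
  by rewrite mul_adjE.
apply: (@eq_psd _ _ (fun i j => \sum_k
    (L i *m W) l k * K i j * ((L j *m W) l k)^*)).
  move=> i j; rewrite mul_adjE mulr_sumr; apply: eq_bigr => k _; ring.
by apply: psd_sum => k; exact: (psd_conj_mul (fun i => (L i *m W) l k)).
Qed.
End FiniteLeech.

(** * Passing from finite sets to the whole domain *)

Section Compactness.
Variable R : realType.
Local Notation C := R[i].

Lemma limC_real (T : Type) (F : set_system T) (FF : ProperFilter F) (f : T -> R) (l : R) :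
  f @ F --> l -> limC (F := F) (fun t => (f t)%:C) l%:C.
Proof.
move=> /cvgrPdist_lt fl; apply/limCP => e e0.
have eR := ge0_ReE (ltW e0).
have eR0 : 0 < complex.Re e by move: e0; rewrite {1}eR ltcR.
have := fl _ eR0; apply: filterS => t.
by rewrite -rmorphB eR normc_def /= expr0n addr0 sqrtr_sqr ltcR.
Qed.

Lemma ultra_bounded_cvg (T : Type) (G : set_system T) (GU : UltraFilter G)
    (f : T -> R) :
  (\forall t \near G, -1 <= f t <= 1) -> exists l : R, f @ G --> l.
Proof.
move=> fb; have := @segment_compact R (-1) 1 (f @ G) _.
case=> [|l [_ ll]].
  by apply: filterS fb => t /=; rewrite in_itv.
exists l => U Ul; have [//|GN] := in_ultra_setVsetC (f @^-1` U) GU.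
have [y [yN yU]] := ll (~` U) U GN Ul.
by case: (yN yU).
Qed.

Lemma ultra_bounded_limC (T : Type) (G : set_system T) (GU : UltraFilter G)
    (f : T -> C) :
  (\forall t \near G, `|f t| <= 1) -> exists l : C, limC (F := G) f l.
Proof.
move=> fb.
have [a ha] : exists l : R, (fun t => complex.Re (f t)) @ G --> l.
  apply: ultra_bounded_cvg; apply: filterS fb => t ft.
  rewrite -ler_norml -lecR (le_trans _ ft) //; exact: normc_ge_Re.
have [b hb] : exists l : R, (fun t => complex.Im (f t)) @ G --> l.
  apply: ultra_bounded_cvg; apply: filterS fb => t ft.
  rewrite -ler_norml -lecR (le_trans _ ft) // -normrN -ReiNIm.
  by rewrite (le_trans (normc_ge_Re _)) // normrM normCi mulr1.
exists (a%:C + 'i%C * b%:C).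
apply: (@near_limC _ _ G _
  (fun t => (complex.Re (f t))%:C + 'i%C * (complex.Im (f t))%:C)).
  by apply: nearW => t; rewrite -complexE.
by apply: limCD; [|apply: limCZ]; exact: limC_real.
Qed.

Variables (X : eqType) (x0 : X) (d : nat) (K : X -> X -> C).
Variables (F : X -> 'I_d -> C) (phi : X -> C).
Hypothesis K0 : forall x y, K x y != 0.
Hypothesis Kp : psd K.
Hypothesis Krec : psd (fun x y => 1 - (K x y)^-1).
Hypothesis KF : psd (fun x y =>
  K x y * (\sum_l F x l * (F y l)^* - phi x * (phi y)^*)).

(** Solve on every finite set by [finite_leech] and let the finite sets grow along
    an ultrafilter.  The values stay in the unit disc, so they converge at every
    point, and both conclusions involve finitely many points at a time. *)
Theorem leech : exists2 psi : X -> 'I_d -> C,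
  forall x, \sum_l F x l * psi x l = phi x &
  forall l, psd (fun x y => K x y * (1 - psi x l * (psi y l)^*)).
Proof.
have hfin (s : seq X) : exists psi : X -> 'I_d -> C,
    (forall x, x \in s -> \sum_l F x l * psi x l = phi x) /\
    forall l (p : seq (C * X)), (forall q, q \in p -> q.2 \in s) ->
      0 <= quadform (fun x y => K x y * (1 - psi x l * (psi y l)^*)) p.
  (* The extra point [x0] makes the index type non-empty. *)
  pose z (i : 'I_(size s).+1) := nth x0 (rcons s x0) i.
  have [Lam LamF Lamp] := @finite_leech R _ d _ (fun i => F (z i)) (fun i => phi (z i))
    (fun i j => K0 (z i) (z j)) (psd_comp z Kp) (psd_comp z Krec) (psd_comp z KF).
  pose sg x : 'I_(size s).+1 := inord (index x s).
  have zs x : x \in s -> z (sg x) = x.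
    move=> xs; rewrite /z inordK; last by rewrite ltnS index_size.
    by rewrite nth_rcons index_mem xs nth_index.
  exists (fun x => Lam (sg x)); split=> [x xs|l p ps].
    by have := LamF (sg x); rewrite zs.
  have := Lamp l [seq (q.1, sg q.2) | q <- p]; congr (0 <= _).
  rewrite /quadform big_map; apply: eq_big_seq => q /ps qs /=.
  by rewrite big_map; apply: eq_big_seq => r /ps rs /=; rewrite !zs.
have [psi hpsi] := choice hfin.
pose Fl : set_system (seq X) :=
  fun A => exists s : seq X, forall t : seq X, {subset s <= t} -> A t.
have FF : ProperFilter Fl.
  split; first by case=> s /(_ s); apply.
  split; first by exists [::].
    move=> A B [s sA] [t tB]; exists (s ++ t) => r str; split.
      by apply: sA => x xs; apply: str; rewrite mem_cat xs.
    by apply: tB => x xs; apply: str; rewrite mem_cat xs orbT.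
  by move=> A B AB [s sA]; exists s => t /sA/AB.
have [G [GU FG]] := ultraFilterLemma FF.
have near_in (x : X) : \forall t \near G, x \in t.
  by apply: FG; exists [:: x] => t h; apply: h; rewrite inE.
have psi_bd x l : \forall t \near G, `|psi t x l| <= 1.
  apply: filterS (near_in x) => t xt.
  have := (hpsi t).2 l [:: (1, x)]; rewrite /quadform !big_seq1 /= rmorph1 !mul1r.
  have Kx : 0 < K x x by rewrite lt_def K0 psd_diag.
  rewrite pmulr_rge0 // subr_ge0 -normCK => h.
  rewrite -(@ler_pXn2r _ 2) ?nnegrE // expr1n; apply: h => q.
  by rewrite inE => /eqP ->.
have /choice[psi' hl] : forall xl : X * 'I_d, exists l : C,
    limC (F := G) (fun t => psi t xl.1 xl.2) l.
  by move=> [x l]; exact: ultra_bounded_limC.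
exists (fun x l => psi' (x, l)).
  move=> x.
  apply: (@limC_unique R _ G _ (fun t => \sum_l F x l * psi t x l)).
    by apply: limC_sum => l; apply: limCZ; exact: (hl (x, l)).
  apply: (@near_limC _ _ G _ (fun=> phi x)); last exact: limC_cst.
  by apply: filterS (near_in x) => t xt; rewrite (hpsi t).1.
move=> l p.
apply: (@limC_ge0 _ _ G _ (fun t => 
   quadform (fun x y => K x y * (1 - psi t x l * (psi t y l)^*)) p)).
  apply: FG; exists (map snd p) => t pt; apply: (hpsi t).2 => q qp.
  by apply: pt; exact: map_f.
apply: limC_sum => q; apply: limC_sum => r; apply: limCZ; apply: limCZ.
apply: limCD; first exact: limC_cst.
apply: limCN; apply: limCM; first exact: (hl (q.2, l)).
by apply: limCJ; exact: (hl (r.2, l)).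
Qed.
End Compactness.

(** * Membership, multipliers and uniform boundedness *)

Section Membership.
Variables (R : realType) (X : Type) (H : rkhs R X).
Local Notation C := R[i].
Local Notation K := (Defs.kernel H).
Local Notation "<[ u , v ]>" := (dot H u v).

Lemma sum_unit (V : nmodType) (F : unit -> V) : \sum_i F i = F tt.
Proof. by rewrite (big_pred1 tt) // => -[]. Qed.

Lemma mem_criterion (h : X -> C) (B : C) : 0 <= B ->
  psd (fun x y => B * K x y - h x * (h y)^*) ->
  exists f : H, [/\ forall x, ev H f x = h x, <[f, f]> <= B &
    exists s : nat -> seq (C * X),
      \sum_(p <- s n) p.1 *: kelt H p.2 @[n --> \oo] --> f].
Proof.
move=> B0 hp.
have [|g [gh gB] [s sg]] := @range_criterion _ _ H X unit (fun x _ => kelt H x) h B B0.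
  by apply: eq_psd hp => x y; rewrite sum_unit kernel_dot.
exists (g tt); split; last by exists s; exact: (sg tt).
  by move=> x; rewrite -gh sum_unit dot_kelt.
by rewrite sum_unit in gB.
Qed.

Lemma mem_psd (f : H) : psd (fun x y => <[f, f]> * K x y - ev H f x * (ev H f y)^*).
Proof.
move=> s; pose v := comb (fun x (_ : unit) => kelt H x) s tt.
have := cauchy_schwarz f v; rewrite -subr_ge0; congr (0 <= _).
have -> : <[v, v]> = quadform K s.
  rewrite -(sum_unit (fun i => <[comb (fun x (_ : unit) => kelt H x) s i,
     comb (fun x (_ : unit) => kelt H x) s i]>)) -quadform_gram /quadform.
  by apply: eq_bigr => p _; apply: eq_bigr => q _; rewrite sum_unit kernel_dot.
rewrite normCK.
have -> : <[f, v]> = \sum_(p <- s) (p.1)^* * ev H f p.2.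
  by rewrite dot_sumr; apply: eq_bigr => p _; rewrite dotZr dot_kelt.
rewrite rmorph_sum mulr_suml /quadform mulr_sumr -sumrB; apply: eq_bigr => p _.
rewrite !mulr_sumr -sumrB; apply: eq_bigr => q _.
by rewrite rmorphM /= conjCK; ring.
Qed.

Lemma span_kelt_dense (f : H) : exists s : nat -> seq (C * X),
  \sum_(p <- s n) p.1 *: kelt H p.2 @[n --> \oo] --> f.
Proof.
have [g [gf _ [s sg]]] := mem_criterion (dot_ge0 f) (@mem_psd f).
by exists s; rewrite -(ev_ext gf).
Qed.

(** If [f] belongs to the space then [psi * f] satisfies [mem_criterion], by
    adding the positivity of [mem_psd] for [f], multiplied by [psi] on both
    sides. *)
Lemma mult_criterion (psi : X -> C) (B : C) : 0 <= B ->
  psd (fun x y => K x y * (B - psi x * (psi y)^*)) -> Mult H psi.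
Proof.
move=> B0 hp f.
have [||g [gh _ _]] := @mem_criterion (fun x => psi x * ev H f x) (<[f, f]> * B).
- by rewrite mulr_ge0 ?dot_ge0.
- have h1 := psdZ (dot_ge0 f) hp.
  have h2 := psd_conj_mul psi (@mem_psd f).
  by apply: eq_psd (psdD h1 h2) => x y; rewrite rmorphM /=; ring.
by exists g.
Qed.

Lemma MultD phi psi : Mult H phi -> Mult H psi -> Mult H (fun x => phi x + psi x).
Proof.
move=> hp hq f; have [g hg] := hp f; have [k hk] := hq f.
by exists (g + k) => x; rewrite evD hg hk mulrDl.
Qed.

Lemma MultM phi psi : Mult H phi -> Mult H psi -> Mult H (fun x => phi x * psi x).
Proof.
move=> hp hq f; have [g hg] := hq f; have [k hk] := hp g.
by exists k => x; rewrite hk hg mulrA.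
Qed.

Lemma Mult_cst c : Mult H (fun _ => c).
Proof. by move=> f; exists (c *: f) => x; rewrite evZ. Qed.

Lemma Mult_sum (I : Type) (r : seq I) (phi : I -> X -> C) :
  (forall i, Mult H (phi i)) -> Mult H (fun x => \sum_(i <- r) phi i x).
Proof.
move=> hp; elim: r => [|i r IH].
  by under eq_fun do rewrite big_nil; exact: Mult_cst.
by under eq_fun do rewrite big_cons; exact: MultD.
Qed.

End Membership.

Section UniformBoundedness.
Variables (R : realType) (X : Type) (H : rkhs R X).
Local Notation C := R[i].
Local Notation "<[ u , v ]>" := (dot H u v).

(** Uniform boundedness by a gliding hump.  If the bound failed there would be
    [w n] in [W] with [`|w n| > 6 * n * 4 ^+ n]; adding or not adding
    a vector of norm [4 ^- n] along [w n] makes the [n]-th partial sum pair with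
    [w n] to at least [4 ^- n * `|w n| / 2], while the later terms change the pairing
    by at most [4 ^- n * `|w n| / 3]. *)
Lemma weakly_bounded (W : set H) :
  (forall u, exists M : C, forall w, W w -> `|<[u, w]>| <= M) ->
  exists2 M : C, 0 <= M & forall w, W w -> `|w| <= M.
Proof.
move=> Wb; apply: contrapT => WN.
have /choice[w hw] : forall n : nat, exists w : H,
    W w /\ 6 * n%:R * 4 ^+ n < `|w|.
  move=> n; apply: contrapT => hN; apply: WN.
  have M0 : 0 <= 6 * n%:R * 4 ^+ n :> C by rewrite !mulr_ge0 ?exprn_ge0.
  exists (6 * n%:R * 4 ^+ n) => // w Ww.
  rewrite real_leNgt ?ger0_real //; apply/negP => h; apply: hN.
  by exists w.
have w0 n : 0 < `|w n| by rewrite (le_lt_trans _ (hw n).2) // !mulr_ge0 ?exprn_ge0.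
pose st n (x : H) : H :=
  if 4 ^- n * `|w n| <= 2 * `|<[x, w n]>| then x
  else x + (4 ^- n / `|w n|) *: w n.
pose x := fix x n := if n is m.+1 then st m (x m) else (0 : H).
have q0 n : 0 < 4 ^- n :> C by rewrite invr_gt0 exprn_gt0.
have xS n : `|x n.+1 - x n| <= 4 ^- n.
  rewrite /= /st; case: ifP => _; first by rewrite subrr normr0 ltW.
  by rewrite addrC addKr normrZ ger0_norm ?divr_ge0 // ?divfK ?gt_eqF // ltW.
have xw n : 4 ^- n * `|w n| <= 2 * `|<[x n.+1, w n]>|.
  rewrite /= /st; case: ifPn => // hN.
  have h : 2 * `|<[x n, w n]>| < 4 ^- n * `|w n|.
    by rewrite real_ltNge ?ger0_real ?mulr_ge0 ?(ltW (q0 n)).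
  rewrite dotDl dotZl -dot_norm.
  set a := 4 ^- n * `|w n|; set b := <[x n, w n]>.
  have -> : 4 ^- n / `|w n| * `|w n| ^+ 2 = a.
    by rewrite expr2 mulrA divfK ?gt_eqF.
  have a0 : 0 <= a by rewrite mulr_ge0 ?ltW.
  have h3 : `|a| <= `|b + a| + `|b|.
    by rewrite -[X in `|X| <= _](addKr b) addrC (le_trans (ler_normD _ _)) // normrN.
  rewrite (ger0_norm a0) in h3.
  rewrite -subr_ge0.
  have -> : 2 * `|b + a| - a = 2 * (`|b + a| + `|b| - a) + (a - 2 * `|b|) by ring.
  by rewrite addr_ge0 ?mulr_ge0 ?subr_ge0 // ltW.
have xk n k : `|x (n.+1 + k)%N - x n.+1| <= (4 ^- n - 4 ^- (n + k)) / 3.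
  elim: k => [|k IH]; first by rewrite !addn0 !subrr normr0 mul0r.
  rewrite addnS -[_ - x n.+1](subrKA (x (n.+1 + k)%N)).
  apply: le_trans (ler_normD _ _) _; apply: le_trans (lerD (xS _) IH) _.
  rewrite addSn addnS !exprS !invfM; set a := 4 ^- n; set b := 4 ^- (n + k).
  by rewrite le_eqVlt; apply/orP; left; apply/eqP; field.
have [z xz] : exists z : H, x @ \oo --> z.
  apply: cauchy_dot_cvg => e e0.
  have [m _ hm] := near_infty_natSinv_lt (PosNum e0).
  exists m.+1 => n mn; rewrite -(subnKC mn) -dot_norm.
  have h4 : 4 ^- m <= m.+1%:R^-1 :> C.
    by rewrite lef_pV2 ?posrE ?exprn_gt0 // -natrX ler_nat ltn_expl.
  have h5 : `|x (m.+1 + (n - m.+1))%N - x m.+1| <= 4 ^- m.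
    apply: le_trans (xk _ _) _; rewrite ler_pdivrMr //.
    rewrite lerBlDr (le_trans _ (_ : 4 ^- m * 3 <= _)) //; last by rewrite lerDl ltW.
    by rewrite ler_peMr ?ler1n // ltW.
  apply: (@le_lt_trans _ _ (m.+1%:R^-1)).
    apply: le_trans h4; rewrite expr2; apply: le_trans (ler_pM _ _ h5 h5) _ => //.
    by rewrite ler_piMr ?(ltW (q0 m)) // invf_le1 ?exprn_gt0 // exprn_ege1 // ler1n.
  have := hm m (leqnn m); rewrite /= -ltcR fmorphV rmorph_nat; exact.
have [M hM] := Wb z.
have hn n : n%:R <= `|<[z, w n]>|.
  have hk k : n%:R <= `|<[x (n.+1 + k)%N, w n]>|.
    have h1 : `|<[x (n.+1 + k)%N - x n.+1, w n]>| <= 4 ^- n / 3 * `|w n|.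
      apply: le_trans (norm_dot_le _ _) _; rewrite ler_wpM2r //.
      by apply: le_trans (xk n k) _; rewrite ler_pM2r ?invr_gt0 // lerBlDr lerDl ltW.
    have h2 := xw n.
    have h3 : `|<[x n.+1, w n]>| <= `|<[x (n.+1 + k)%N, w n]>| +
        `|<[x (n.+1 + k)%N - x n.+1, w n]>|.
      rewrite dotDl dotNl; set a := <[x n.+1, _]>; set b := <[_, _]>.
      by rewrite -{1}(subKr b a) (le_trans (ler_normD _ _)) // normrN.
    have h4 : n%:R * 6 <= 4 ^- n * `|w n|.
      have := ltW (hw n).2; rewrite -(ler_pM2l (q0 n)); apply: le_trans.
      by rewrite le_eqVlt; apply/orP; left; apply/eqP; field; rewrite expf_neq0.
    rewrite -(@ler_pM2r _ 6) // -subr_ge0.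
    set a := `|<[x n.+1, _]>| in h2 h3; set b := `|<[x (n.+1 + k)%N, _]>| in h3 *.
    set c := `|<[x (n.+1 + k)%N - _, _]>| in h1 h3; set v := 4 ^- n * _ in h2 h4.
    have h1' : c <= v / 3 by rewrite (le_trans h1) // /v mulrAC.
    have -> : b * 6 - n%:R * 6 = 6 * (b + c - a) + 3 * (2 * a - v) + 6 * (v / 3 - c) +
       (v - n%:R * 6) by field.
    apply: addr_ge0; [apply: addr_ge0; [apply: addr_ge0|]|]; rewrite ?mulr_ge0 ?subr_ge0 //.
  rewrite -subr_ge0; apply: (@limC_ge0 _ _ \oo _ (fun m => `|<[x m, w n]>| - n%:R)).
    by exists n.+1 => // m /= nm; rewrite -(subnKC nm) subr_ge0.
  apply: limCD; last exact: limC_cst.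
  by apply: limC_norm; exact: cvg_dotl.
have M0 : 0 <= M by apply: le_trans (hM _ (hw 0).1).
have eR := ge0_ReE M0.
have := le_trans (hn (Num.truncn (complex.Re M)).+1) (hM _ (hw _).1).
rewrite eR -(rmorph_nat (real_complex R)) lecR leNgt truncnS_gt //.
Qed.
End UniformBoundedness.

(** * Factorisation of multipliers *)

Section Factorisation.
Variables (R : realType) (X : eqType) (H : rkhs R X) (d : nat).
Local Notation C := R[i].
Local Notation K := (Defs.kernel H).
Local Notation "<[ u , v ]>" := (dot H u v).
Variables (F : X -> 'I_d -> C) (phi : X -> C).

Definition pointwise_factors := forall u : H, exists g : 'I_d -> H,
  forall x, phi x * ev H u x = \sum_l F x l * ev H (g l) x.

(** The vectors [w] of [W] below are the images of kernel combinations under the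
    adjoint of multiplication by [phi], normalised by their images under the
    adjoint of the row [F].  A factorisation of [phi * u] bounds [dot u w] on [W],
    so [W] is weakly bounded. *)
Lemma pointwise_factors_bound : pointwise_factors ->
  exists2 B : C, 0 <= B &
    psd (fun x y => K x y * (B * (\sum_l F x l * (F y l)^*) - phi x * (phi y)^*)).
Proof.
move=> hF.
pose e x l := (F x l)^* *: kelt H x.
pose e' x (_ : unit) := (phi x)^* *: kelt H x.
pose Q s := \sum_l <[comb e s l, comb e s l]>.
have Q0 s : 0 <= Q s by apply: sumr_ge0 => l _; exact: dot_ge0.
pose W := [set w : H | exists s (t : C), [/\ 0 < t, Q s <= t ^+ 2 &
  w = t^-1 *: comb e' s tt]].
have [|M M0 hM] := @weakly_bounded _ _ H W.
  move=> u; have [g hg] := hF u; exists (\sum_l `|g l|) => _ [s [t [t0 Qt ->]]].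
  have -> : <[u, t^-1 *: comb e' s tt]> = t^-1 * \sum_l <[g l, comb e s l]>.
    rewrite dotZr nneg_conj ?invr_ge0 ?ltW //; congr (_ * _).
    rewrite dot_sumr; under [RHS]eq_bigr do rewrite dot_sumr.
    rewrite exchange_big; apply: eq_bigr => p _ /=.
    rewrite !dotZr dot_kelt conjCK hg mulr_sumr; apply: eq_bigr => l _.
    by rewrite !dotZr dot_kelt conjCK.
  rewrite normrM ger0_norm ?invr_ge0 ?(ltW t0) // mulrC ler_pdivrMr //.
  apply: le_trans (ler_norm_sum _ _ _) _; rewrite mulr_suml; apply: ler_sum => l _.
  apply: le_trans (norm_dot_le _ _) _; rewrite ler_wpM2l //.
  rewrite -(@ler_pXn2r _ 2) ?nnegrE ?(ltW t0) // dot_norm; apply: le_trans Qt.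
  by rewrite /Q (bigD1 l) //= lerDl; apply: sumr_ge0 => j _; exact: dot_ge0.
exists (M ^+ 2); first by rewrite exprn_ge0.
move=> s; set lhs := quadform _ s.
have -> : lhs = M ^+ 2 * Q s - <[comb e' s tt, comb e' s tt]>.
  rewrite -(sum_unit (fun i => <[comb e' s i, comb e' s i]>)) /Q -!quadform_gram.
  rewrite /lhs /quadform mulr_sumr -sumrB; apply: eq_bigr => p _.
  rewrite mulr_sumr -sumrB; apply: eq_bigr => q _.
  rewrite sum_unit !dotZl !dotZr conjCK -kernel_dot.
  under [in RHS]eq_bigr do rewrite !dotZl !dotZr conjCK -kernel_dot.
  have -> : \sum_l (F q.2 l)^* * (F p.2 l * K p.2 q.2) =
      K p.2 q.2 * \sum_l F p.2 l * (F q.2 l)^*.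
    by rewrite mulr_sumr; apply: eq_bigr => l _; ring.
  by ring.
(* The extra [n.+1%:R^-1] keeps the normalising constant positive. *)
apply: (@limC_ge0 _ _ \oo _ (fun n => M ^+ 2 * Q s -
   <[comb e' s tt, comb e' s tt]> + M ^+ 2 * n.+1%:R^-1)); last first.
  rewrite -[X in limC _ X]addr0; apply: limCD; first exact: limC_cst.
  by rewrite -(mulr0 (M ^+ 2)); apply: limCZ; exact: limC_natSinv.
apply: nearW => n; have n0 : 0 < n.+1%:R^-1 :> C by rewrite invr_gt0.
have t0 : 0 < Q s + n.+1%:R^-1 by rewrite ltr_wpDl.
have : W ((sqrtC (Q s + n.+1%:R^-1))^-1 *: comb e' s tt).
  exists s, (sqrtC (Q s + n.+1%:R^-1)); split=> //; first by rewrite sqrtC_gt0.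
  by rewrite sqrtCK lerDl ltW.
move=> /hM; rewrite normrZ ger0_norm ?invr_ge0 ?sqrtC_ge0 ?(ltW t0) //.
rewrite mulrC ler_pdivrMr ?sqrtC_gt0 // => h.
rewrite addrAC -mulrDr subr_ge0 -dot_norm -[X in _ * X]sqrtCK -exprMn.
by rewrite ler_pXn2r ?nnegrE ?mulr_ge0 ?sqrtC_ge0 // ltW.
Qed.

Hypothesis K0 : forall x y, K x y != 0.
Variable x0 : X.
Hypothesis Kx0 : forall x, K x x0 = 1.

Theorem multiplier_factorisation : complete_nevanlinna_pick H ->
  pointwise_factors -> exists2 psi : 'I_d -> X -> C,
    (forall l, Mult H (psi l)) & forall x, phi x = \sum_l F x l * psi l x.
Proof.
move=> cnp /pointwise_factors_bound[B B0 hB].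
pose b := sqrtC B; have b0 : 0 <= b by rewrite sqrtC_ge0.
have [||||psi hpsi psip] := @leech R X x0 d K (fun x l => b * F x l) phi.
- exact: K0.
- exact: psd_kernel.
- apply: eq_psd (psd_reciprocal K0 x0 cnp) => x y.
  by rewrite /reciprocal !Kx0 -kernelJ Kx0 rmorph1 !mul1r.
- apply: eq_psd hB => x y; congr (_ * (_ - _)); rewrite mulr_sumr.
  apply: eq_bigr => l _; rewrite rmorphM /= (nneg_conj b0) -[in LHS](sqrtCK B) -/b.
  by ring.
exists (fun l x => b * psi x l).
  move=> l; apply: MultM; first exact: Mult_cst.
  by apply: (@mult_criterion _ _ _ _ 1).
by move=> x; rewrite -hpsi; apply: eq_bigr => l _; ring.
Qed.
End Factorisation.

(** * Taylor coefficients *)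

Section TaylorCoefficients.
Variable R : realType.

(** Weights at the points [0, ..., n] that extract the coefficient of degree [n]
    of a polynomial of degree at most [n]. *)
Lemma vandermonde_dual n : exists c : 'I_n.+1 -> R,
  forall m, (m <= n)%N -> \sum_i c i * i%:R ^+ m = (m == n)%:R.
Proof.
pose V := Vandermonde n.+1 (\row_(i < n.+1) (i%:R : R)).
have Vu : V \in unitmx.
  rewrite unitmxE det_Vandermonde unitfE; apply/prodf_neq0 => i _.
  apply/prodf_neq0 => j ij; rewrite !mxE subr_eq0 eqr_nat.
  by rewrite gtn_eqF.
exists (fun i => (invmx V) i ord_max) => m mn.
have mn1 : (m < n.+1)%N by [].
have /matrixP/(_ (Ordinal mn1) ord_max) := mulmxV Vu.
rewrite mxE [X in _ = X]mxE -val_eqE /= => <-; apply: eq_bigr => i _.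
by rewrite !mxE mulrC.
Qed.

Lemma ge0_of_linear (b M e0 : R) : 0 < e0 -> 0 <= M ->
  (forall e, 0 < e <= e0 -> 0 <= b + M * e) -> 0 <= b.
Proof.
move=> e00 M0 h; rewrite leNgt; apply/negP => b0.
have M1 : 0 < M + 1 by rewrite ltr_wpDl.
pose e := Num.min e0 (- b / 2 / (M + 1)).
have e2 : 0 < - b / 2 / (M + 1) by rewrite !divr_gt0 // oppr_gt0.
have e1 : 0 < e by rewrite lt_min e00.
have := h e; rewrite e1 ge_min lexx /= => /(_ isT).
have : M * e <= - b / 2.
  apply: (@le_trans _ _ ((M + 1) * (- b / 2 / (M + 1)))).
    apply: ler_pM => //; [exact: ltW|by rewrite lerDl|].
    by rewrite ge_min lexx orbT.
  by rewrite mulrC divfK // gt_eqF.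
lra.
Qed.

(** At the points [sqrt e * i] with the weights of [vandermonde_dual], the quadratic
    form equals [b n * e ^+ n] up to an error of order [e ^+ n.+1]. *)
Lemma taylor_coef_ge0 (f : R -> R) (b : nat -> R) (M dl : R) n :
  0 < dl -> 0 <= M ->
  (forall u, 0 <= u <= dl -> `|f u - \sum_(m < n.+1) b m * u ^+ m| <= M * u ^+ n.+1) ->
  (forall (I : finType) (s c : I -> R), (forall i, 0 <= s i) ->
     (forall i j, s i * s j <= dl) ->
     0 <= \sum_i \sum_j c i * c j * f (s i * s j)) -> 0 <= b n.
Proof.
move=> dl0 M0 hf hpos; have [c hc] := vandermonde_dual n.
pose M' := \sum_i \sum_j `|c i * c j| * (M * (i%:R * j%:R) ^+ n.+1).
have N0 : 0 < n.+1%:R ^+ 2 :> R by rewrite exprn_gt0 // ltr0n.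
apply: (@ge0_of_linear _ M' (dl / n.+1%:R ^+ 2)).
- by rewrite divr_gt0.
- by do 2!apply: sumr_ge0 => ? _; rewrite !mulr_ge0 ?exprn_ge0 ?mulr_ge0.
move=> e /andP[e0 ed].
have ij (i j : 'I_n.+1) : (Num.sqrt e * i%:R) * (Num.sqrt e * j%:R) = e * (i%:R * j%:R).
  by rewrite mulrACA -expr2 sqr_sqrtr // ltW.
have ijd (i j : 'I_n.+1) : 0 <= e * (i%:R * j%:R) <= dl.
  rewrite !mulr_ge0 ?(ltW e0) //=; rewrite ler_pdivlMr // in ed.
  apply: le_trans ed; rewrite ler_pM2l // expr2.
  by rewrite ler_pM // ler_nat ltnW.
pose S := \sum_(i < n.+1) \sum_(j < n.+1)
  c i * c j * f ((Num.sqrt e * i%:R) * (Num.sqrt e * j%:R)).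
have S0 : 0 <= S.
  apply: (hpos _ (fun i : 'I_n.+1 => Num.sqrt e * i%:R)) => [i|i j].
    by rewrite mulr_ge0 ?sqrtr_ge0.
  by rewrite ij; case/andP: (ijd i j).
pose q u := \sum_(m < n.+1) b m * u ^+ m.
have qE : \sum_(i < n.+1) \sum_(j < n.+1) c i * c j * q (e * (i%:R * j%:R)) = b n * e ^+ n.
  transitivity (\sum_(m < n.+1) b m * e ^+ m * (\sum_i c i * i%:R ^+ m) ^+ 2).
    rewrite /q; under eq_bigr do under eq_bigr do rewrite mulr_sumr.
    under eq_bigr do rewrite exchange_big; rewrite exchange_big /=.
    apply: eq_bigr => m _; rewrite expr2 mulr_suml mulr_sumr; apply: eq_bigr => i _.
    rewrite !mulr_sumr; apply: eq_bigr => j _; rewrite !exprMn; ring.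
  rewrite big_ord_recr /= big1 ?add0r => [|m _].
    by rewrite hc // eqxx expr1n mulr1.
  by rewrite hc ?(ltnW (ltn_ord m)) // ltn_eqF ?ltn_ord //= expr0n mulr0.
have Sle : S <= b n * e ^+ n + M' * e ^+ n.+1.
  rewrite -qE /S /M' mulr_suml -big_split; apply: ler_sum => i _ /=.
  rewrite mulr_suml -big_split; apply: ler_sum => j _ /=; rewrite ij -lerBlDl -mulrBr.
  apply: le_trans (ler_norm _) _; rewrite normrM -mulrA ler_wpM2l //.
  apply: le_trans (hf _ (ijd i j)) _.
  by rewrite -mulrA ler_wpM2l // [e * _]mulrC exprMn.
have := le_trans S0 Sle.
rewrite exprS.
have -> : b n * e ^+ n + M' * (e * e ^+ n) = (b n + M' * e) * e ^+ n by ring.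
by rewrite pmulr_lge0 // exprn_gt0.
Qed.
End TaylorCoefficients.

Section ReciprocalSeries.
Variables (R : realType) (a : nat -> R).
Hypothesis a0 : a 0%N = 1.

(** The Taylor coefficients of [1 - 1 / \sum_n a n * t ^ n]. *)
Lemma reciprocal_coefs : exists b : nat -> R, b 0%N = 0 /\
  forall n, (0 < n)%N -> \sum_(j < n.+1) b j * a (n - j)%N = a n.
Proof.
pose nxt s := if size s is n.+1 then a n.+1 - \sum_(j < n.+1) nth 0 s j * a (n.+1 - j)%N else 0.
pose bs := fix bs n := if n is m.+1 then rcons (bs m) (nxt (bs m)) else [::].
have sz n : size (bs n) = n by elim: n => //= n IH; rewrite size_rcons IH.
pose b n := nth 0 (bs n.+1) n.
have bE n j : (j < n)%N -> nth 0 (bs n) j = b j.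
  elim: n => // n IH; rewrite ltnS leq_eqVlt => /orP[/eqP -> //|jn].
  by rewrite /= nth_rcons sz jn IH.
exists b; split; first by [].
case=> // n _; rewrite big_ord_recr /= subnn a0 mulr1.
rewrite [X in _ + X](_ : b n.+1 = a n.+1 - \sum_(j < n.+1) b j * a (n.+1 - j)%N).
  by rewrite addrC subrK.
rewrite {1}/b -[bs n.+2]/(rcons (bs n.+1) (nxt (bs n.+1))) nth_rcons sz ltnn eqxx /nxt sz.
by congr (_ - _); apply: eq_bigr => j _; rewrite bE.
Qed.

Lemma poly_tail (p : {poly R}) N : (forall m, (m < N)%N -> p`_m = 0) ->
  exists2 M, 0 <= M & forall u, 0 <= u <= 1 -> `|p.[u]| <= M * u ^+ N.
Proof.
move=> p0; exists (\sum_(i < size p) `|p`_i|); first exact: sumr_ge0.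
move=> u /andP[u0 u1]; rewrite horner_coef mulr_suml.
apply: le_trans (ler_norm_sum _ _ _) _; apply: ler_sum => i _.
have [iN|iN] := ltnP i N; first by rewrite p0 // mul0r normr0 mul0r.
rewrite normrM ler_wpM2l // ger0_norm ?exprn_ge0 //.
by rewrite ler_wiXn2l.
Qed.

(** [(1 - b) * a = 1] holds up to order [n] for the truncated series, so
    [1 - 1/g - b = (g * (1 - b) - 1) / g] is of order [n.+1]. *)
Lemma reciprocal_taylor (g : R -> R) (b : nat -> R) n (M dl : R) :
  b 0%N = 0 ->
  (forall n, (0 < n)%N -> \sum_(j < n.+1) b j * a (n - j)%N = a n) ->
  0 <= M -> dl <= 1 ->
  (forall u, 0 <= u <= dl -> 1 <= g u) ->
  (forall u, 0 <= u <= dl -> `|g u - \sum_(k < n.+1) a k * u ^+ k| <= M * u ^+ n.+1) ->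
  exists2 M', 0 <= M' & forall u, 0 <= u <= dl ->
    `|1 - (g u)^-1 - \sum_(k < n.+1) b k * u ^+ k| <= M' * u ^+ n.+1.
Proof.
move=> b0 hb M0 dl1 g1 hg.
pose p := \poly_(k < n.+1) a k; pose q := \poly_(k < n.+1) b k.
have [M1 M10 hM1] := @poly_tail (1 - q) 0 (fun m (h : (m < 0)%N) => False_ind _ (notF h)).
have [M2 M20 hM2] : exists2 M2, 0 <= M2 & forall u, 0 <= u <= 1 ->
    `|(p * (1 - q) - 1).[u]| <= M2 * u ^+ n.+1.
  apply: poly_tail => m mn; rewrite mulrBr mulr1 !coefB coef1 coefMr.
  have -> : \sum_(j < m.+1) p`_(m - j) * q`_j = \sum_(j < m.+1) b j * a (m - j)%N.
    apply: eq_bigr => j _; rewrite !coef_poly ltnS (leq_trans (leq_subr _ _)) //.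
    by rewrite (leq_ltn_trans _ mn) 1?mulrC // -ltnS ltn_ord.
  rewrite coef_poly mn; case: m mn => [|m] mn.
    by rewrite big_ord1 b0 mul0r a0 subr0 subrr.
  by rewrite hb // subrr subr0.
exists (M * M1 + M2); first by rewrite addr_ge0 // mulr_ge0.
move=> u /[dup] udl /andP[u0 ud]; have u1 : 0 <= u <= 1 by rewrite u0 (le_trans ud).
have pE : \sum_(k < n.+1) a k * u ^+ k = p.[u] by rewrite horner_poly.
have qE : \sum_(k < n.+1) b k * u ^+ k = q.[u] by rewrite horner_poly.
have g0 : 0 < g u by rewrite (lt_le_trans ltr01) // g1.
have -> : 1 - (g u)^-1 - \sum_(k < n.+1) b k * u ^+ k =
   ((g u - p.[u]) * (1 - q).[u] + (p * (1 - q) - 1).[u]) / g u.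
  have q1 : (1 - q).[u] = 1 - q.[u] by rewrite hornerD hornerN hornerC.
  have pq : (p * (1 - q) - 1).[u] = p.[u] * (1 - q.[u]) - 1.
    by rewrite hornerD hornerN hornerM q1 hornerC.
  by rewrite qE pq q1; field; rewrite gt_eqF.
rewrite normrM [`|_^-1|]ger0_norm ?invr_ge0 ?(ltW g0) // ler_pdivrMr //.
apply: (@le_trans _ _ ((M * M1 + M2) * u ^+ n.+1)); last first.
  by rewrite ler_peMr ?g1 // mulr_ge0 ?exprn_ge0 // addr_ge0 // mulr_ge0.
apply: le_trans (ler_normD _ _) _; rewrite [X in _ <= X]mulrDl lerD ?hM2 // normrM -mulrA [M1 * _]mulrC mulrA.
by rewrite ler_pM // -?pE ?hg // (le_trans (hM1 _ u1)) // expr0 mulr1.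
Qed.
End ReciprocalSeries.

(** * Unitarily invariant kernels *)

Section PowerKernels.
Variables (R : realType) (d : nat) (D : set 'rV[R[i]]_d).
Local Notation C := R[i].
Implicit Types (x y : D).

Lemma psd_cdot_mul (L : D -> D -> C) : psd L ->
  psd (fun x y => cdot (val x) (val y) * L x y).
Proof.
move=> Lp; apply: (@eq_psd _ _ (fun x y =>
  \sum_(i < d) Defs.coord i x * L x y * (Defs.coord i y)^*)).
  by move=> x y; rewrite /cdot mulr_suml; apply: eq_bigr => i _; rewrite /Defs.coord; ring.
by apply: psd_sum => i; exact: psd_conj_mul.
Qed.

Lemma psd_cdot_pow n : psd (fun x y => cdot (val x) (val y) ^+ n).
Proof.
elim: n => [|n IH]; first exact: psd_const1.
by apply: eq_psd (psd_cdot_mul IH) => x y; rewrite exprS.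
Qed.

Definition power_sum (c : nat -> R) N (x y : D) : C :=
  \sum_(n < N) (c n)%:C * cdot (val x) (val y) ^+ n.

Lemma psd_power_sum c N : (forall n, 0 <= c n) -> psd (power_sum c N).
Proof.
by move=> c0; apply: psd_sum => n; apply: psdZ (psd_cdot_pow n); rewrite ler0c.
Qed.

Lemma psd_lim (L : nat -> D -> D -> C) (M : D -> D -> C) :
  (forall n, psd (L n)) ->
  (forall x y, limC (F := \oo) (fun n => L n x y) (M x y)) -> psd M.
Proof.
move=> Lp LM s; apply: (@limC_ge0 _ _ \oo _ (fun n => quadform (L n) s)).
  by apply: nearW => n; exact: Lp.
by apply: limC_sum => p; apply: limC_sum => q; apply: limCZ; exact: LM.
Qed.

Definition power_kernel (c : nat -> R) (L : D -> D -> C) :=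
  forall x y, limC (F := \oo) (fun N => power_sum c N x y) (L x y).

Lemma psd_power_kernel c L : (forall n, 0 <= c n) -> power_kernel c L -> psd L.
Proof. by move=> c0; apply: psd_lim => N; exact: psd_power_sum. Qed.

Lemma power_kernelD c c' L L' : power_kernel c L -> power_kernel c' L' ->
  power_kernel (fun n => c n + c' n) (fun x y => L x y + L' x y).
Proof.
move=> cL cL' x y.
apply: (@near_limC _ _ \oo _ (fun N => power_sum c N x y + power_sum c' N x y)).
  apply: nearW => N; rewrite /power_sum -big_split; apply: eq_bigr => n _ /=.
  by rewrite rmorphD /= mulrDl.
by apply: limCD.
Qed.

Lemma power_kernelZ (t : R) c L : power_kernel c L ->
  power_kernel (fun n => t * c n) (fun x y => t%:C * L x y).
Proof.
move=> cL x y; apply: (@near_limC _ _ \oo _ (fun N => t%:C * power_sum c N x y)).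
  apply: nearW => N; rewrite /power_sum mulr_sumr; apply: eq_bigr => n _ /=.
  by rewrite rmorphM /= mulrA.
by apply: limCZ.
Qed.

Lemma power_kernel_trunc c N :
  power_kernel (fun n => if (n < N)%N then c n else 0) (power_sum c N).
Proof.
move=> x y; apply: (@near_limC _ _ \oo _ (fun=> power_sum c N x y)); last exact: limC_cst.
exists N => // M /= NM; rewrite /power_sum (big_ord_widen _ (fun n => (c n)%:C * _ ^+ n) NM).
rewrite big_mkcond; apply: eq_bigr => n _ /=; case: ifP => // _.
by rewrite mul0r.
Qed.

Lemma power_kernel_shift c L : power_kernel c L ->
  power_kernel (fun n => if n is m.+1 then c m else 0)
    (fun x y => cdot (val x) (val y) * L x y).
Proof.
move=> cL x y.
have h : limC (F := \oo) (fun N => cdot (val x) (val y) * power_sum c N x y)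
    (cdot (val x) (val y) * L x y) by apply: limCZ.
move/limCP: h => h; apply/limCP => e e0; have [N _ hN] := h e e0.
exists N.+1 => // -[//|n] /= Nn; have := hN n Nn; congr (`|_ - _| < e).
rewrite /power_sum big_ord_recl /= mul0r add0r mulr_sumr; apply: eq_bigr => m _.
by rewrite exprS; ring.
Qed.
End PowerKernels.

(** * Growth of the coefficients *)

Section CoefficientGrowth.
Variables (R : realType) (d : nat) (d_gt0 : (0 < d)%N) (D : set 'rV[R[i]]_d).
Hypothesis D_ball : D = oball R d \/ D = cball R d.
Variables (H : rkhs R D) (a : nat -> R) (H_cnp : unitarily_invariant_cnp H a).
Local Notation C := R[i].
Local Notation K := (Defs.kernel H).
Local Notation "<[ u , v ]>" := (dot H u v).

Lemma coef_at0 : a 0%N = 1. Proof. by case: H_cnp => -[]. Qed.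
Lemma coef_ge0 n : 0 <= a n. Proof. by case: H_cnp => -[]. Qed.

Lemma kernel_neq0 x y : K x y != 0.
Proof. by case: H_cnp => _ _ _ _ [[h _] _]; exact: h. Qed.

Lemma kernel_power : power_kernel a K.
Proof.
case: H_cnp => _ h _ _ _ x y.
apply: (@near_limC _ _ \oo _ (series (fun n => (a n)%:C * cdot (val x) (val y) ^+ n : C^o))).
  by apply: nearW => N; rewrite /series /= big_mkord.
by apply: cvg_limC; exact: h.
Qed.

Lemma oball_sub z : oball R d z -> D z.
Proof. by case: D_ball => -> //; exact: ltW. Qed.

Lemma cdotr0 (z : 'rV[C]_d) : cdot z 0 = 0.
Proof. by rewrite /cdot big1 // => i _; rewrite mxE conjC0 mulr0. Qed.

Lemma oball0 : oball R d 0.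
Proof. by rewrite /oball /= cdotr0. Qed.

Definition origin : D := SigSub (mem_set (oball_sub oball0)).

Lemma kernel_origin x : K x origin = 1.
Proof.
apply: (@limC_unique R _ \oo _ (fun N => power_sum a N x origin)); first exact: kernel_power.
apply: (@near_limC _ _ \oo _ (fun=> 1)); last exact: limC_cst.
exists 1%N => // -[//|N] _.
rewrite /power_sum big_ord_recl /= cdotr0 expr0 coef_at0 mulr1 big1 ?addr0 // => n _.
by rewrite expr0n mulr0.
Qed.

Let ray (s : R) : 'rV[C]_d := \row_i (if i == Ordinal d_gt0 then s%:C else 0).

Lemma cdot_ray s t : cdot (ray s) (ray t) = (s * t)%:C.
Proof.
rewrite /cdot (bigD1 (Ordinal d_gt0)) //= !mxE eqxx big1 ?addr0.
  by rewrite rmorphM; congr (_ * _); exact: conjc_real.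
by move=> i /negPf ii; rewrite !mxE ii mul0r.
Qed.

Let P (s : R) : D := insubd origin (ray s).

Lemma val_P s : 0 <= s <= 2^-1 -> val (P s) = ray s.
Proof.
move=> /andP[s0 s1]; rewrite val_insubd mem_set //; apply: oball_sub.
rewrite /oball /= cdot_ray -[1]/(1%:C) ltcR.
by apply: (@le_lt_trans _ _ (2^-1 * 2^-1)); [exact: ler_pM|lra].
Qed.

Let rs N u := \sum_(n < N) a n * u ^+ n.

Lemma power_sum_P N s t : 0 <= s <= 2^-1 -> 0 <= t <= 2^-1 ->
  power_sum a N (P s) (P t) = (rs N (s * t))%:C.
Proof.
move=> hs ht; rewrite /power_sum !val_P // cdot_ray rmorph_sum; apply: eq_bigr => n _.
by rewrite [RHS]rmorphM [in RHS]rmorphXn.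
Qed.

(** The generating function [\sum_n a n * u ^+ n], read off from the kernel at two
    points of a radius. *)
Let g u := complex.Re (K (P (2 * u)) (P 2^-1)).

Lemma half_int : 0 <= (2^-1 : R) <= 2^-1. Proof. by rewrite invr_ge0 ler0n lexx. Qed.

Lemma lim_rs u : 0 <= u <= 4^-1 -> limC (F := \oo) (fun N => (rs N u)%:C) (g u)%:C.
Proof.
move=> hu; have h2u : 0 <= 2 * u <= 2^-1 by case/andP: hu => *; apply/andP; split; lra.
have h : limC (F := \oo) (fun N => (rs N u)%:C) (K (P (2 * u)) (P 2^-1)).
  apply: (@near_limC _ _ \oo _ (fun N => power_sum a N (P (2 * u)) (P 2^-1))).
    apply: nearW => N; rewrite power_sum_P ?half_int //; congr (rs N _)%:C.
    by rewrite mulrAC divff ?mul1r.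
  exact: kernel_power.
have K0 : 0 <= K (P (2 * u)) (P 2^-1).
  apply: limC_ge0 h; apply: nearW => N; rewrite ler0c /rs.
  by apply: sumr_ge0 => n _; rewrite mulr_ge0 ?coef_ge0 ?exprn_ge0 //; case/andP: hu.
by rewrite /g RRe_real ?ger0_real.
Qed.

Lemma kernel_P s t : 0 <= s <= 2^-1 -> 0 <= t <= 2^-1 -> K (P s) (P t) = (g (s * t))%:C.
Proof.
move=> hs ht; apply: (@limC_unique R _ \oo _ (fun N => (rs N (s * t))%:C)).
  apply: (@near_limC _ _ \oo _ (fun N => power_sum a N (P s) (P t))).
    by apply: nearW => N; rewrite power_sum_P.
  exact: kernel_power.
apply: lim_rs; case/andP: hs => s0 s1; case/andP: ht => t0 t1.
rewrite mulr_ge0 //=; apply: (@le_trans _ _ (2^-1 * 2^-1)); [exact: ler_pM|lra].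
Qed.

Lemma limR_le (f h : nat -> R) (l m : R) : (\forall n \near \oo, f n <= h n) ->
  limC (F := \oo) (fun n => (f n)%:C) l%:C -> limC (F := \oo) (fun n => (h n)%:C) m%:C -> l <= m.
Proof.
move=> fh fl hm; rewrite -subr_ge0 -ler0c rmorphB /=.
apply: (@limC_ge0 _ _ \oo _ (fun n => (h n)%:C - (f n)%:C)).
  by apply: filterS fh => n; rewrite -rmorphB ler0c subr_ge0.
exact: (limCD hm (limCN fl)).
Qed.

(** The factor [4 ^+ n] comes from comparing with the series at [u = 4^-1]. *)
Lemma rs_sub N n u : (n <= N)%N -> 0 <= u <= 4^-1 ->
  0 <= rs N u - rs n u <= 4 ^+ n * rs N 4^-1 * u ^+ n.
Proof.
move=> nN /andP[u0 u1].
have -> : rs N u - rs n u = \sum_(k < N | (n <= k)%N) a k * u ^+ k.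
  rewrite /rs (big_ord_widen _ (fun k => a k * u ^+ k) nN) (bigID (fun k : 'I_N => (k < n)%N)) /=.
  by rewrite addrAC subrr add0r; apply: eq_bigl => k; rewrite -leqNgt.
rewrite sumr_ge0 /=; last by move=> k _; rewrite mulr_ge0 ?coef_ge0 ?exprn_ge0.
rewrite /rs mulr_sumr mulr_suml [X in _ <= X](bigID (fun k : 'I_N => (n <= k)%N)) /=.
apply: ler_wpDr.
  by apply: sumr_ge0 => k _; rewrite !mulr_ge0 ?coef_ge0 ?exprn_ge0 ?invr_ge0.
apply: ler_sum => k nk.
have -> : 4 ^+ n * (a k * 4^-1 ^+ k) * u ^+ n = a k * (4^-1 ^+ (k - n) * u ^+ n).
  have -> : 4^-1 ^+ k = 4^-1 ^+ (k - n) * 4^-1 ^+ n :> R by rewrite -exprD subnK.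
  have : (4 : R) ^+ n * 4^-1 ^+ n = 1 by rewrite -exprMn divff ?expr1n.
  set A := 4 ^+ n; set B := 4^-1 ^+ n => h.
  by rewrite -[RHS]mulr1 -h; ring.
have -> : u ^+ k = u ^+ (k - n) * u ^+ n by rewrite -exprD subnK.
rewrite ler_wpM2l ?coef_ge0 // ler_wpM2r ?exprn_ge0 //.
by rewrite lerXn2r ?nnegrE ?invr_ge0.
Qed.

Lemma g_approx n u : 0 <= u <= 4^-1 ->
  `|g u - rs n u| <= 4 ^+ n * g 4^-1 * u ^+ n.
Proof.
move=> hu; have h4 : 0 <= (4^-1 : R) <= 4^-1 by rewrite invr_ge0 ler0n lexx.
have cst (l : R) : limC (F := \oo) (fun=> l%:C) l%:C by exact: limC_cst.
have h1 : rs n u <= g u.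
  apply: (limR_le _ (cst _) (lim_rs hu)); exists n => // N /= nN.
  by have /andP[] := rs_sub nN hu; rewrite subr_ge0.
rewrite ger0_norm ?subr_ge0 // lerBlDr.
have h2 : limC (F := \oo) (fun N => (4 ^+ n * rs N 4^-1 * u ^+ n + rs n u)%:C)
    (4 ^+ n * g 4^-1 * u ^+ n + rs n u)%:C.
  rewrite rmorphD !rmorphM /=.
  apply: (@near_limC _ _ \oo _ (fun N => (4 ^+ n)%:C * (rs N 4^-1)%:C * (u ^+ n)%:C + (rs n u)%:C)).
    by apply: nearW => N; rewrite !rmorphD !rmorphM.
  apply: limCD; last exact: limC_cst.
  by apply: limCM; [apply: limCZ; exact: (lim_rs h4)|exact: limC_cst].
apply: (limR_le _ (lim_rs hu) h2); exists n => // N /= nN.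
by have /andP[_] := rs_sub nN hu; rewrite lerBlDr.
Qed.

Lemma g_ge1 u : 0 <= u <= 4^-1 -> 1 <= g u.
Proof.
have cst (l : R) : limC (F := \oo) (fun=> l%:C) l%:C by exact: limC_cst.
move=> hu; apply: (limR_le _ (cst _) (lim_rs hu)); exists 1%N => // -[//|N] _.
rewrite /rs big_ord_recl expr0 mulr1 coef_at0 lerDl; apply: sumr_ge0 => n _.
by rewrite mulr_ge0 ?coef_ge0 ?exprn_ge0 //; case/andP: hu.
Qed.

Lemma psd_diff (X : Type) (L : X -> X -> C) x y : psd L ->
  0 <= L x x - L x y - L y x + L y y.
Proof.
move/(_ [:: (1, x); (-1, y)]); rewrite /quadform !big_cons !big_nil /=.
by rewrite !addr0 rmorphN rmorph1; congr (0 <= _); ring.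
Qed.

(** A coordinate function [f] belongs to the space, so [s ^+ 2] is at most
    [|f| ^ 2 * (g (s ^+ 2) - 1)] by positivity at the points of radii [0] and [s];
    with [a 1 = 0] the right-hand side would be of order [s ^+ 4]. *)
Lemma coef1_gt0 : 0 < a 1.
Proof.
rewrite lt_def coef_ge0 andbT; apply/eqP => a1.
case: H_cnp => _ _ /(_ (Ordinal d_gt0))[f hf] _ _.
have fB : <[f, f]> = (complex.Re <[f, f]>)%:C by rewrite RRe_real ?ger0_real ?dot_ge0.
set B := complex.Re _ in fB.
have B0 : 0 <= B by rewrite -ler0c -fB dot_ge0.
pose M := 4 ^+ 2 * g 4^-1.
have M0 : 0 <= M.
  by rewrite mulr_ge0 ?exprn_ge0 // (le_trans ler01) // g_ge1 // invr_ge0 ler0n lexx.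
have key s : 0 <= s <= 2^-1 -> s ^+ 2 <= B * (M * s ^+ 4).
  move=> hs; have h0 : 0 <= (0 : R) <= 2^-1 by rewrite lexx invr_ge0 ler0n.
  have P0 : P 0 = origin.
    by apply: val_inj; rewrite val_P //; apply/rowP => i; rewrite !mxE if_same.
  have fs : ev H f (P s) = s%:C by rewrite hf /Defs.coord val_P // mxE eqxx.
  have f0 : ev H f origin = 0 by rewrite hf /Defs.coord mxE.
  have := psd_diff (P s) origin (mem_psd f).
  cbv beta; rewrite fs f0 fB -(kernelJ H (P s) origin) !kernel_origin rmorph1 (kernel_P hs hs).
  have sJ : (s%:C)^* = s%:C by apply: nneg_conj; rewrite ler0c; case/andP: hs.
  rewrite sJ.
  set t := _ + _; have -> : t = (B * (g (s * s) - 1) - s * s)%:C.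
    by rewrite /t conjC0 !(rmorphB, rmorphM, rmorph1) /=; ring.
  rewrite ler0c subr_ge0 -expr2 => /le_trans; apply; rewrite ler_wpM2l //.
  have h1 : 0 <= s * s <= 4^-1.
    case/andP: hs => s0 s1; rewrite mulr_ge0 //=.
    by apply: (@le_trans _ _ (2^-1 * 2^-1)); [exact: ler_pM|lra].
  have := g_approx 2 h1; rewrite /rs !big_ord_recr big_ord0 /= a1 coef_at0.
  rewrite mul0r addr0 add0r expr0 mulr1 => /(le_trans (ler_norm _)).
  by rewrite -expr2 -exprM.
pose s := Num.min 2^-1 (2 * (B * M + 1))^-1.
have BM : 0 <= B * M by rewrite mulr_ge0.
have s0 : 0 < s by rewrite lt_min !invr_gt0 mulr_gt0 ?ltr_wpDl.
have s1 : s <= 2^-1 by rewrite ge_min lexx.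
have := key s; rewrite (ltW s0) s1 => /(_ isT).
have -> : B * (M * s ^+ 4) = s ^+ 2 * (B * M * s * s) by ring.
rewrite -[X in X <= _]mulr1 ler_pM2l ?exprn_gt0 // => h.
have : B * M * s <= 2^-1.
  have s2 : s <= (2 * (B * M + 1))^-1 by rewrite ge_min lexx orbT.
  apply: le_trans (ler_wpM2l BM s2) _.
  rewrite ler_pdivrMr ?mulr_gt0 ?ltr_wpDl //.
  by have -> : 2^-1 * (2 * (B * M + 1)) = B * M + 1; [field|rewrite lerDl].
move=> h2.
have : B * M * s * s <= 2^-1 * 2^-1.
  by have s0' := ltW s0; apply: ler_pM => //; exact: mulr_ge0.
lra.
Qed.

(** With [b] the Taylor coefficients of the reciprocal kernel,
    [a n.+1 = b 1 * a n + b 2 * a n.-1 + ...] has non-negative terms, and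
    [b 1 = a 1]. *)
Lemma coef_growth n : a 1 * a n <= a n.+1.
Proof.
have [b [b0 hb]] := reciprocal_coefs coef_at0.
have dl0 : 0 < (4^-1 : R) by rewrite invr_gt0.
have b_ge0 m : 0 <= b m.
  have h4 : 0 <= (4^-1 : R) <= 4^-1 by rewrite invr_ge0 ler0n lexx.
  have M0 : 0 <= 4 ^+ m.+1 * g 4^-1.
    by rewrite mulr_ge0 ?exprn_ge0 // (le_trans ler01) // g_ge1.
  have [|M' M'0 hM'] := reciprocal_taylor coef_at0 b0 hb M0 _ g_ge1 (@g_approx m.+1).
    by rewrite invf_le1 // ler1n.
  apply: (taylor_coef_ge0 dl0 M'0 hM') => I s c s0 ss.
  have sh i : 0 <= s i <= 2^-1.
    rewrite s0 /= -(@ler_pXn2r _ 2) ?nnegrE ?invr_ge0 // expr2 (le_trans (ss i i)) //.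
    by rewrite exprVn -natrX.
  have cnp : complete_nevanlinna_pick H by case: H_cnp => _ _ _ _ [].
  have := psd_form (fun i => (c i)%:C) (psd_comp (fun i => P (s i))
    (psd_reciprocal kernel_neq0 origin cnp)).
  rewrite -ler0c; congr (0 <= _); rewrite rmorph_sum; apply: eq_bigr => i _ /=.
  rewrite rmorph_sum; apply: eq_bigr => j _ /=.
  rewrite /reciprocal kernel_P // !kernel_origin -(kernelJ H (P (s j)) origin).
  rewrite kernel_origin rmorph1 !mul1r !rmorphM rmorphB rmorph1 fmorphV /=.
  by congr (_ * _ * _); exact: conjc_real.
have b1 : b 1%N = a 1.
  by rewrite -(hb 1%N) // !big_ord_recl big_ord0 /= b0 coef_at0; ring.
rewrite -(hb n.+1) // 2!big_ord_recl /= b0 mul0r add0r subSS subn0 b1 lerDl.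
by apply: sumr_ge0 => j _; rewrite mulr_ge0 ?coef_ge0.
Qed.

Lemma coef_gt0 n : 0 < a n.
Proof.
elim: n => [|n IH]; first by rewrite coef_at0.
by rewrite (lt_le_trans _ (coef_growth n)) // mulr_gt0 ?coef1_gt0.
Qed.

(** The kernel [((a 1)^-1 - <x, y>) * K x y] is a power series with coefficients
    [a n / a 1 - a n.-1 >= 0] for [n > 0]; the coordinates other than [i] only help. *)
Lemma coord_Mult (i : 'I_d) : Mult H (Defs.coord i).
Proof.
pose B : R := (a 1)^-1.
apply: (@mult_criterion _ _ _ _ B%:C); first by rewrite ler0c invr_ge0 ltW ?coef1_gt0.
pose c n := B * a n + (- 1) * (if n is m.+1 then a m else 0).
have c0 n : 0 <= c n.
  rewrite /c mulN1r subr_ge0 /B mulrC ler_pdivlMr ?coef1_gt0 // mulrC.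
  by case: n => [|n]; [rewrite mulr0 coef_ge0|exact: coef_growth].
have h1 := psd_power_kernel c0 (power_kernelD (power_kernelZ (t := B) kernel_power)
  (power_kernelZ (t := -1) (power_kernel_shift kernel_power))).
have h2 : psd (fun x y => \sum_(j < d | j != i) Defs.coord j x * K x y * (Defs.coord j y)^*).
  apply: (@eq_psd _ _ (fun x y => \sum_(j < d)
     (if j != i then Defs.coord j x else 0) * K x y * (if j != i then Defs.coord j y else 0)^*)).
    move=> x y; rewrite [RHS]big_mkcond; apply: eq_bigr => j _.
    by case: ifP => // _; rewrite !mul0r.
  apply: psd_sum => j.
  by apply: (psd_conj_mul (L := K) (fun x => if j != i then Defs.coord j x else 0)); exact: psd_kernel.
apply: eq_psd (psdD h1 h2) => x y.
rewrite rmorphN rmorph1 mulN1r /cdot (bigD1 i) //= mulrDl opprD.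
have -> : \sum_(j < d | j != i) Defs.coord j x * K x y * (Defs.coord j y)^* =
  (\sum_(j < d | j != i) val x 0 j * (val y 0 j)^*) * K x y.
  by rewrite mulr_suml; apply: eq_bigr => j _; rewrite /Defs.coord; ring.
by rewrite /Defs.coord; ring.
Qed.
End CoefficientGrowth.

(** * Gleason's problem *)

Section Gleason.
Variables (R : realType) (d : nat) (d_gt0 : (0 < d)%N) (D : set 'rV[R[i]]_d).
Hypothesis D_ball : D = oball R d \/ D = cball R d.
Variables (H : rkhs R D) (a : nat -> R) (H_cnp : unitarily_invariant_cnp H a).
Local Notation C := R[i].
Local Notation K := (Defs.kernel H).
Local Notation "<[ u , v ]>" := (dot H u v).
Local Notation z_ := (@Defs.coord R d D).
Local Notation origin := (origin D_ball).
Let Kpow := kernel_power H_cnp.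
Let age0 := coef_ge0 H_cnp.
Let coordM := coord_Mult d_gt0 D_ball H_cnp.

Let one : H := kelt H origin.

Lemma ev_one x : ev H one x = 1.
Proof. by rewrite -[LHS]/(K x origin) (kernel_origin D_ball H_cnp). Qed.

Lemma Mult_mem phi : Mult H phi -> exists f : H, forall x, ev H f x = phi x.
Proof. by move=> /(_ one)[f hf]; exists f => x; rewrite hf ev_one mulr1. Qed.

(** This class contains the polynomials and is what is used about them; unlike
    an explicit space of polynomials it needs no monomial bookkeeping. *)
Definition decomposable (phi : D -> C) := Mult H phi /\
  forall l : D, exists2 psi : 'I_d -> D -> C, (forall i, Mult H (psi i)) &
    forall x, phi x - phi l = \sum_i (z_ i x - z_ i l) * psi i x.

Lemma decomposable_cst c : decomposable (fun=> c).
Proof.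
split; first exact: Mult_cst.
move=> l; exists (fun _ _ => 0) => [i|x]; first exact: Mult_cst.
by rewrite subrr big1 // => i _; rewrite mulr0.
Qed.

Lemma decomposable_coord i : decomposable (z_ i).
Proof.
split=> [|l]; first exact: coordM.
exists (fun j _ => (j == i)%:R) => [j|x]; first exact: Mult_cst.
rewrite (bigD1 i) //= eqxx mulr1 big1 ?addr0 // => j /negPf ->.
by rewrite mulr0.
Qed.

Lemma decomposableD phi psi : decomposable phi -> decomposable psi ->
  decomposable (fun x => phi x + psi x).
Proof.
move=> [hp hp'] [hq hq']; split=> [|l]; first exact: MultD.
have [u uM uE] := hp' l; have [v vM vE] := hq' l.
exists (fun i x => u i x + v i x) => [i|x]; first exact: MultD.
rewrite opprD addrACA uE vE -big_split; apply: eq_bigr => i _ /=.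
by rewrite mulrDr.
Qed.

Lemma decomposableM phi psi : decomposable phi -> decomposable psi ->
  decomposable (fun x => phi x * psi x).
Proof.
move=> [hp hp'] [hq hq']; split=> [|l]; first exact: MultM.
have [u uM uE] := hp' l; have [v vM vE] := hq' l.
exists (fun i x => phi x * v i x + psi l * u i x) => [i|x].
  by apply: MultD; apply: MultM => //; exact: Mult_cst.
transitivity (phi x * (psi x - psi l) + psi l * (phi x - phi l)); first by ring.
rewrite uE vE !mulr_sumr -big_split; apply: eq_bigr => i _ /=.
by ring.
Qed.

Lemma decomposable_sum (I : Type) (r : seq I) (phi : I -> D -> C) :
  (forall i, decomposable (phi i)) -> decomposable (fun x => \sum_(i <- r) phi i x).
Proof.
move=> hp; elim: r => [|i r IH].
  by under eq_fun do rewrite big_nil; exact: decomposable_cst.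
by under eq_fun do rewrite big_cons; exact: decomposableD.
Qed.

Lemma decomposable_cdot w n : decomposable (fun x => cdot (val x) w ^+ n).
Proof.
elim: n => [|n IH]; first by under eq_fun do rewrite expr0; exact: decomposable_cst.
under eq_fun do rewrite exprS; apply: decomposableM => //.
apply: decomposable_sum => i; apply: decomposableM; last exact: decomposable_cst.
exact: decomposable_coord.
Qed.

Lemma decomposable_power_sum N w : decomposable (fun x => power_sum a N x w).
Proof.
apply: decomposable_sum => n; apply: decomposableM; first exact: decomposable_cst.
exact: decomposable_cdot.
Qed.

Lemma squeeze_cvg (v : nat -> H) (g : H) (t : nat -> C) :
  (forall n, <[v n - g, v n - g]> <= t n) -> limC (F := \oo) t 0 -> v @ \oo --> g.
Proof.
move=> vt /limCP t0; apply/cvgrPdist_lt => e e0.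
have := t0 _ (exprn_gt0 2 e0); apply: filterS => n.
rewrite sub0r normrN => tn; rewrite distrC -(@ltr_pXn2r _ 2) ?nnegrE ?(ltW e0) //.
rewrite dot_norm; apply: le_lt_trans (vt n) _; apply: le_lt_trans tn.
by rewrite real_ler_norm // ger0_real // (le_trans _ (vt n)) // dot_ge0.
Qed.

(** The remainder [T N] of the power series of [K] is a positive kernel dominated by
    [K], so its function [T N ^~ w] has squared norm at most [T N w w], which
    tends to 0. *)
Lemma kelt_approx w : exists p : nat -> H,
  (forall N x, ev H (p N) x = power_sum a N x w) /\ p @ \oo --> kelt H w.
Proof.
pose T N x y := K x y - power_sum a N x y.
have Tp N : psd (T N).
  have h := power_kernelD Kpow (power_kernelZ (t := -1) (@power_kernel_trunc R d D a N)).
  apply: eq_psd (psd_power_kernel _ h) => [x y|n].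
    by rewrite rmorphN rmorph1 mulN1r.
  by case: ifP => _; rewrite mulN1r ?subrr // oppr0 addr0 age0.
have /choice[f hf] : forall N, exists f : H,
    (forall x, ev H f x = T N x w) /\ <[f, f]> <= T N w w.
  move=> N; have Tw := psd_diag w (Tp N).
  have [|f [fT fB _]] := @mem_criterion _ _ H (fun x => T N x w) _ Tw.
    have h1 := psd_schur_complement w (Tp N).
    have h2 := psdZ Tw (@psd_power_sum R d D a N age0).
    apply: eq_psd (psdD h1 h2) => x y.
    rewrite (psd_herm y w (Tp N)) [T N x y]/T; ring.
  by exists f.
exists (fun N => kelt H w - f N); split=> [N x|].
  by rewrite evD evN (hf N).1 /T subKr.
apply: (@squeeze_cvg _ _ (fun N => T N w w)).
  by move=> N; rewrite addrC addKr dotNl dotNr opprK (hf N).2.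
rewrite -(subrr (K w w)); apply: limCD; first exact: limC_cst.
by apply: limCN; exact: Kpow.
Qed.

Lemma decomposable_dense (f : H) (e : C) : 0 < e ->
  exists2 p : H, decomposable (ev H p) & `|f - p| < e.
Proof.
pose A (g : H) := forall e : C, 0 < e ->
  exists2 p : H, decomposable (ev H p) & `|g - p| < e.
have Alim (v : nat -> H) g : (forall n, A (v n)) -> v @ \oo --> g -> A g.
  move=> vA vg e' e'0; have e2 : 0 < e' / 2 by rewrite divr_gt0.
  move/cvgrPdist_lt : vg => vg; have [N _ hN] := vg _ e2.
  have [p pd ph] := vA N _ e2; exists p => //.
  rewrite -(subrKA (v N)) [e']splitr; apply: le_lt_trans (ler_normD _ _) _.
  by rewrite ltrD // hN /=.
have Akelt w : A (kelt H w).
  have [p [pE pl]] := kelt_approx w; apply: Alim pl => N e' e'0.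
  exists (p N); last by rewrite subrr normr0.
  rewrite (_ : ev H (p N) = fun x => power_sum a N x w); last exact/funext.
  exact: decomposable_power_sum.
have AD g h : A g -> A h -> A (g + h).
  move=> Ag Ah e' e'0; have e2 : 0 < e' / 2 by rewrite divr_gt0.
  have [p pd ph] := Ag _ e2; have [q qd qh] := Ah _ e2.
  exists (p + q).
    rewrite (_ : ev H (p + q) = fun x => ev H p x + ev H q x); last by apply/funext => x; rewrite evD.
    exact: decomposableD.
  rewrite opprD addrACA [e']splitr; apply: le_lt_trans (ler_normD _ _) _.
  exact: ltrD.
have AZ c g : A g -> A (c *: g).
  move=> Ag e' e'0; have c0 : 0 < `|c| + 1 by rewrite ltr_wpDl.
  have [p pd ph] := Ag _ (divr_gt0 e'0 c0); exists (c *: p).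
    rewrite (_ : ev H (c *: p) = fun x => c * ev H p x); last by apply/funext => x; rewrite evZ.
    by apply: decomposableM => //; exact: decomposable_cst.
  rewrite ltr_pdivlMr // in ph; rewrite -scalerBr normrZ; apply: le_lt_trans ph.
  by rewrite mulrC ler_wpM2l // lerDl.
have Asum (s : seq (C * D)) : A (\sum_(p <- s) p.1 *: kelt H p.2).
  elim: s => [|p s IH]; last by rewrite big_cons; apply: AD => //; apply: AZ.
  rewrite big_nil => e' e'0; exists 0; last by rewrite subrr normr0.
  rewrite (_ : ev H 0 = fun=> 0); last by apply/funext => x; rewrite -dot_kelt dot0l.
  exact: decomposable_cst.
by have [s hs] := span_kelt_dense f; exact: (Alim _ _ (fun n => Asum (s n)) hs).
Qed.

Lemma decomposable_range phi (l : D) : decomposable phi -> phi l = 0 ->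
  exists g : 'I_d -> H, forall x, phi x = \sum_i (z_ i x - z_ i l) * ev H (g i) x.
Proof.
move=> [_ /(_ l)[psi psiM psiE]] phil.
have /choice[g hg] : forall i, exists g : H, forall x, ev H g x = psi i x.
  by move=> i; exact: Mult_mem.
exists g => x; have := psiE x; rewrite phil subr0 => ->; apply: eq_bigr => i _.
by rewrite hg.
Qed.

(** If [p] is decomposable and close to [f] then [p - p(l)] lies in the range and is
    close to [f] too, because [f l = 0] makes [p(l)] small. *)
Lemma closed_range_full (l : D) : closed (coordinate_range (H := H) l) ->
  forall f : H, ev H f l = 0 -> coordinate_range (H := H) l f.
Proof.
move=> cl f fl.
pose c := 1 + `|kelt H l| * `|one|.
have c0 : 0 < c by rewrite ltr_wpDr // mulr_ge0.
have /choice[q hq] : forall n : nat, exists q : H,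
    coordinate_range (H := H) l q /\ `|f - q| <= n.+1%:R^-1.
  move=> n; have e0 : 0 < n.+1%:R^-1 / c :> C by rewrite divr_gt0 // invr_gt0.
  have [p pd fp] := decomposable_dense f e0.
  exists (p - ev H p l *: one); split.
    have [||g hg] := @decomposable_range (fun x => ev H p x + - ev H p l) l.
    - by apply: decomposableD => //; exact: decomposable_cst.
    - by rewrite subrr.
    by exists g => x; rewrite evD evN evZ ev_one mulr1 hg.
  have pl : `|ev H p l| <= `|f - p| * `|kelt H l|.
    have e : ev H (f - p) l = - ev H p l by rewrite evD evN fl add0r.
    have -> : `|ev H p l| = `|ev H (f - p) l| by rewrite e normrN.
    by rewrite -dot_kelt norm_dot_le.
  rewrite opprB addrCA addrC.
  apply: le_trans (ler_normD _ _) _; rewrite normrZ.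
  apply: (@le_trans _ _ (`|f - p| * c)).
    by rewrite /c mulrDr mulr1 lerD2l mulrA ler_wpM2r.
  by rewrite -ler_pdivlMr // ltW.
apply: (@closed_cvg _ _ \oo _ q _ cl); first by apply: nearW => n; case: (hq n).
apply/cvgrPdist_lt => e e0; have /limCP/(_ e e0) := @limC_natSinv R.
apply: filterS => n; rewrite sub0r normrN ger0_norm ?invr_ge0 //.
by apply: le_lt_trans; case: (hq n).
Qed.

Theorem closed_range_gleason :
  (forall l : D, oball R d (val l) -> closed (coordinate_range (H := H) l)) ->
  gleason_solvable H.
Proof.
move=> hb l lb phi phiM.
have cnp : complete_nevanlinna_pick H by case: H_cnp => _ _ _ _ [].
have [|psi psiM psiE] := @multiplier_factorisation R D H d
  (fun x i => z_ i x - z_ i l) (fun x => phi x - phi l)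
  (kernel_neq0 H_cnp) origin (kernel_origin D_ball H_cnp) cnp.
  move=> u.
  have pM : Mult H (fun x => phi x - phi l) by apply: MultD => //; exact: Mult_cst.
  have [f hf] := pM u.
  have [|g hg] := @closed_range_full l (hb l lb) f; first by rewrite hf subrr mul0r.
  by exists g => x; rewrite -hf hg.
by exists psi.
Qed.

Definition finite_gram (L : D -> D -> C) := exists (I : finType) (u : I -> D -> C),
  (forall i, decomposable (u i)) /\
  forall x y, L x y = \sum_i u i x * (u i y)^*.

Lemma finite_gram_power_sum N : finite_gram (power_sum a N).
Proof.
have gD L M : finite_gram L -> finite_gram M -> finite_gram (fun x y => L x y + M x y).
  move=> [I [u [ud uE]]] [J [v [vd vE]]].
  exists (I + J)%type, (fun k => match k with inl i => u i | inr j => v j end).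
  split=> [[i|j] //|x y]; by rewrite uE vE big_sumType.
have gpow n : finite_gram (fun x y => cdot (val x) (val y) ^+ n).
  elim: n => [|n [I [u [ud uE]]]].
    exists unit, (fun _ _ => 1); split=> [_|x y]; first exact: decomposable_cst.
    by rewrite sum_unit rmorph1 mulr1.
  exists ('I_d * I)%type, (fun k x => z_ k.1 x * u k.2 x); split=> [k|x y].
    by apply: decomposableM => //; exact: decomposable_coord.
  rewrite exprS uE /cdot mulr_suml -(pair_bigA _ (fun i j => z_ i x * u j x * (z_ i y * u j y)^*)) /=.
  apply: eq_bigr => i _; rewrite mulr_sumr; apply: eq_bigr => j _.
  by rewrite rmorphM /Defs.coord /=; ring.
have gZ n L : finite_gram L -> finite_gram (fun x y => (a n)%:C * L x y).
  move=> [I [u [ud uE]]].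
  have an0 : 0 <= (a n)%:C by rewrite ler0c.
  exists I, (fun i x => sqrtC (a n)%:C * u i x); split=> [i|x y].
    by apply: decomposableM => //; exact: decomposable_cst.
  rewrite uE mulr_sumr; apply: eq_bigr => i _; rewrite rmorphM /=.
  by rewrite (@nneg_conj _ (sqrtC _)) ?sqrtC_ge0 // -{1}(sqrtCK (a n)%:C); ring.
elim: N => [|N IH].
  exists void, (fun _ _ => 0); split=> [[]|x y].
  by rewrite /power_sum big_ord0 big1 // => -[].
have [I [u [ud uE]]] := gD _ _ IH (gZ N _ (gpow N)).
exists I, u; split=> // x y.
by rewrite -uE /power_sum big_ord_recr.
Qed.

(** With [lam = |l|^2 < rho < 1], completing a square gives
    [<x - l, y - l> >= (1 - rho) * (<x, y> - lam / rho)] as kernels.  The right-hand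
    side times [K] has coefficients [a_(n-1) - t * a_n] with
    [t = lam / rho < 1]; these exceed a multiple of [a_n] for large [n] by the
    hypothesis on the ratios, and the finitely many others are compensated by
    [power_sum]. *)
Lemma range_kernel_bound (l : D) : oball R d (val l) ->
  (fun n => a n / a n.+1) @ \oo --> (1 : R) ->
  exists N (B : C), 0 <= B /\
    psd (fun x y => B * ((\sum_i (z_ i x - z_ i l) * (z_ i y - z_ i l)^*) * K x y +
       power_sum a N x y) - K x y).
Proof.
move=> lb ca.
pose lam := complex.Re (cdot (val l) (val l)).
have lE : cdot (val l) (val l) = lam%:C.
  rewrite RRe_real // ger0_real // sumr_ge0 // => i _; exact: mul_conjC_ge0.
have lam0 : 0 <= lam.
  by rewrite -ler0c -lE sumr_ge0 // => i _; exact: mul_conjC_ge0.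
have lam1 : lam < 1 by move: lb; rewrite /oball /= lE -[1]/(1%:C) ltcR.
pose rho := (lam + 1) / 2.
have rho0 : 0 < rho by rewrite /rho; lra.
have rho1 : rho < 1 by rewrite /rho; lra.
have lrho : lam < rho by rewrite /rho; lra.
pose t := lam / rho.
have t0 : 0 <= t by rewrite divr_ge0 // ltW.
have t1 : t < 1 by rewrite ltr_pdivrMr // mul1r.
pose dl := (1 - t) / 2.
have dl0 : 0 < dl by rewrite /dl; lra.
move/cvgrPdist_lt : ca => ca; have [N _ hN] := ca _ dl0.
have aN n : (N <= n)%N -> (t + dl) * a n.+1 <= a n.
  move=> /hN /=; rewrite ltr_norml => /andP[_ h].
  have h1 : t + dl <= a n / a n.+1 by rewrite /dl in h *; lra.
  by rewrite -ler_pdivlMr // (coef_gt0 d_gt0 D_ball H_cnp).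
pose M x y := cdot (val x) (val y) * K x y + ((- t)%:C * K x y +
   ((t + dl)%:C * power_sum a N.+1 x y + (- dl)%:C * K x y)).
have Mp : psd M.
  have h := power_kernelD (power_kernel_shift Kpow) (power_kernelD (power_kernelZ (t := - t) Kpow)
   (power_kernelD (power_kernelZ (t := t + dl) (@power_kernel_trunc R d D a N.+1))
                  (power_kernelZ (t := - dl) Kpow))).
  apply: psd_power_kernel h => -[|n] /=.
    by rewrite add0r; have := age0 0%N; nra.
  case: ifPn => [|]; rewrite ?ltnS -?ltnNge => nN.
    by have := age0 n; lra.
  have := aN n nN; lra.
pose w i x := z_ i x - (rho^-1)%:C * z_ i l.
have sumE (c : R) x y : \sum_i (z_ i x - c%:C * z_ i l) * (z_ i y - c%:C * z_ i l)^* =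
    cdot (val x) (val y) - c%:C * cdot (val x) (val l) - c%:C * cdot (val l) (val y) +
    c%:C ^+ 2 * lam%:C.
  rewrite -lE /cdot !mulr_sumr -!sumrB -big_split; apply: eq_bigr => i _ /=.
  rewrite rmorphB rmorphM /Defs.coord /=.
  have -> : (c%:C)^* = c%:C by exact: conjc_real.
  by ring.
have Wp : psd (fun x y => \sum_i w i x * K x y * (w i y)^*).
  by apply: psd_sum => i; apply: (psd_conj_mul (L := K) (w i)); exact: psd_kernel.
have dr0 : 0 < (1 - rho) * dl by rewrite mulr_gt0 // subr_gt0.
pose B : R := ((1 - rho) * dl)^-1.
have B0 : 0 <= B by rewrite invr_ge0 ltW.
have tdl : 0 <= 1 - (1 - rho) * (t + dl).
  have : (1 - rho) * (t + dl) <= 1 * 1 by apply: ler_pM; rewrite /dl; lra.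
  lra.
exists N.+1, B%:C; split; first by rewrite ler0c.
have Bc : 0 <= B%:C by rewrite ler0c.
have h1 : 0 <= (1 - rho)%:C by rewrite ler0c subr_ge0 ltW.
have h2 : 0 <= rho%:C by rewrite ler0c ltW.
have h3 : 0 <= (1 - (1 - rho) * (t + dl))%:C by rewrite ler0c.
have hp := psdZ Bc (psdD (psdD (psdZ h1 Mp) (psdZ h2 Wp))
  (psdZ h3 (@psd_power_sum R d D a N.+1 age0))).
apply: eq_psd hp => x y.
have -> : \sum_i w i x * K x y * (w i y)^* =
    (\sum_i (z_ i x - (rho^-1)%:C * z_ i l) * (z_ i y - (rho^-1)%:C * z_ i l)^*) * K x y.
  by rewrite mulr_suml; apply: eq_bigr => i _; rewrite /w; ring.
have -> : \sum_i (z_ i x - z_ i l) * (z_ i y - z_ i l)^* =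
    \sum_i (z_ i x - 1%:C * z_ i l) * (z_ i y - 1%:C * z_ i l)^*.
  by apply: eq_bigr => i _; rewrite !rmorph1 !mul1r.
rewrite [X in _ = _ - X](_ : K x y = (B * ((1 - rho) * dl))%:C * K x y); last first.
  by rewrite mulVf ?gt_eqF // rmorph1 mul1r.
rewrite !sumE /M.
have tE : t%:C = lam%:C / rho%:C by rewrite /t rmorphM fmorphV.
have rC : rho%:C != 0 by rewrite -(rmorph0 (real_complex R)) (inj_eq (@complexI R)) gt_eqF.
have dC : dl%:C != 0 by rewrite -(rmorph0 (real_complex R)) (inj_eq (@complexI R)) gt_eqF.
clearbody B t; clearbody dl; clearbody rho.
rewrite !(rmorphM, rmorphB, rmorphD, rmorphN, fmorphV, rmorph1) /= tE.
by field.
Qed.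

(** The range is the kernel of evaluation at [l].  The criterion is applied to the
    row of the [z_i - l_i] enlarged by the finitely many functions [u j], which act
    on constants only. *)
Theorem ratio_closed_range :
  (fun n => a n / a n.+1) @ \oo --> (1 : R) ->
  forall l : D, oball R d (val l) -> closed (coordinate_range (H := H) l).
Proof.
move=> ca l lb.
suff -> : coordinate_range (H := H) l = [set f : H | ev H f l = 0].
  move=> f fcl /=; apply/eqP; rewrite -normr_eq0; apply: contraT => fl0.
  have k0 : 0 < `|kelt H l| + 1 by rewrite ltr_wpDl.
  have e0 : 0 < `|ev H f l| / (`|kelt H l| + 1) by rewrite divr_gt0 // lt_def fl0 /=.
  have [g [/= gl]] := fcl _ (nbhsx_ballx f _ e0).
  rewrite -ball_normE /= ltr_pdivlMr // => fg.
  have : `|ev H f l| < `|ev H f l|; last by rewrite ltxx.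
  apply: le_lt_trans fg.
  have {1}-> : ev H f l = <[f - g, kelt H l]> by rewrite dot_kelt evD evN gl subr0.
  by rewrite (le_trans (norm_dot_le _ _)) // ler_wpM2l // lerDl.
apply/seteqP; split=> [f [g fg]|f /= fl].
  by rewrite /= fg big1 // => i _; rewrite subrr mul0r.
have [N [B [B0 hB]]] := range_kernel_bound lb ca.
have [I [u [ud uE]]] := finite_gram_power_sum N.
pose e x (k : 'I_d + I) := match k with
  | inl i => (z_ i x - z_ i l)^* *: kelt H x
  | inr j => (u j x)^* *: one end.
have [||g [gE _] _] := @range_criterion _ _ H D ('I_d + I)%type e (ev H f) (<[f, f]> * B).
- by rewrite mulr_ge0 ?dot_ge0.
- have h := psdD (psdZ (dot_ge0 f) hB) (mem_psd f).
  apply: eq_psd h => x y; rewrite big_sumType /= uE /e.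
  have -> : \sum_i <[(z_ i y - z_ i l)^* *: kelt H y, (z_ i x - z_ i l)^* *: kelt H x]> =
     (\sum_i (z_ i x - z_ i l) * (z_ i y - z_ i l)^*) * K x y.
    rewrite mulr_suml; apply: eq_bigr => i _.
    by rewrite dotZl dotZr conjCK -kernel_dot; ring.
  have -> : \sum_i <[(u i y)^* *: one, (u i x)^* *: one]> = \sum_i u i x * (u i y)^*.
    apply: eq_bigr => i _; rewrite dotZl dotZr conjCK dot_kelt ev_one; ring.
  by ring.
pose p x := \sum_j u j x * <[g (inr j), one]>.
have pd : decomposable p.
  by apply: decomposable_sum => j; apply: decomposableM => //; exact: decomposable_cst.
have fE x : ev H f x = \sum_i (z_ i x - z_ i l) * ev H (g (inl i)) x + p x.
  rewrite -gE big_sumType /= /e /p; congr (_ + _); apply: eq_bigr => i _.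
    by rewrite dotZr conjCK dot_kelt.
  by rewrite dotZr conjCK.
have pl : p l = 0.
  by move: (fE l); rewrite fl big1 ?add0r // => i _; rewrite subrr mul0r.
have [q hq] := decomposable_range pd pl.
exists (fun i => g (inl i) + q i) => x.
by rewrite fE hq -big_split; apply: eq_bigr => i _ /=; rewrite evD mulrDr.
Qed.

Theorem gleason_tame : gleason_solvable H -> tame H.
Proof.
move=> ga rho [rhoL rhoM [phi0 phi0M phi00]] lb.
set lv := \row_i rho _ in lb *.
pose l : D := SigSub (mem_set (oball_sub D_ball lb)).
exists l => // phi phiM.
have rho1 : rho (fun=> 1) = 1.
  apply: (mulfI phi00); rewrite mulr1 -rhoM //; last exact: Mult_cst.
  by congr rho; apply/funext => x; rewrite mulr1.
have rho0 : rho (fun=> 0) = 0.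
  transitivity (-1 * rho (fun=> 1) + rho (fun=> 1)); last by rewrite mulN1r addNr.
  rewrite -rhoL; [|exact: Mult_cst|exact: Mult_cst].
  by congr rho; apply/funext => x; rewrite mulr1 addNr.
have rhoc c : rho (fun=> c) = c.
  transitivity (c * rho (fun=> 1) + rho (fun=> 0)); last by rewrite rho1 rho0 mulr1 addr0.
  rewrite -rhoL; [|exact: Mult_cst|exact: Mult_cst].
  by congr rho; apply/funext => x; rewrite mulr1 addr0.
have rhoD f h : Mult H f -> Mult H h -> rho (fun x => f x + h x) = rho f + rho h.
  move=> fM hM; rewrite -[X in _ = X + _]mul1r -rhoL //.
  by congr rho; apply/funext => x; rewrite mul1r.
have rho_sum (r : seq 'I_d) (f : 'I_d -> D -> C) : (forall i, Mult H (f i)) ->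
    rho (fun x => \sum_(i <- r) f i x) = \sum_(i <- r) rho (f i).
  move=> fM; elim: r => [|i r IH].
    by rewrite big_nil -[RHS]rho0; congr rho; apply/funext => x; rewrite big_nil.
  rewrite big_cons -IH -rhoD //; last exact: Mult_sum.
  by congr rho; apply/funext => x; rewrite big_cons.
have [psi psiM psiE] := ga l lb phi phiM.
have zM i : Mult H (fun x => z_ i x + - z_ i l).
  by apply: MultD => //; exact: Mult_cst.
have phiE : phi = fun x => \sum_i (z_ i x - z_ i l) * psi i x + phi l.
  by apply/funext => x; rewrite -psiE subrK.
rewrite {1}phiE rhoD ?rhoc; last exact: Mult_cst.
  rewrite rho_sum => [|i]; last exact: MultM.
  rewrite big1 ?add0r // => i _; rewrite rhoM // rhoD // ?rhoc; last exact: Mult_cst.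
  have -> : z_ i l = rho (z_ i) by rewrite {1}/Defs.coord /= mxE.
  by rewrite subrr mul0r.
by apply: Mult_sum => i; exact: MultM.
Qed.
End Gleason.

Theorem proposition8p5 (R : realType) (d : nat) (d_gt0 : (0 < d)%N)
    (D : set 'rV[R[i]]_d) (D_ball : D = oball R d \/ D = cball R d)
    (H : rkhs R D) (a : nat -> R) (H_cnp : unitarily_invariant_cnp H a) :
  let cond_a := gleason_solvable H in
  let cond_b := forall l : D, oball R d (val l) ->
    closed (coordinate_range (H := H) l) in
  let cond_c := (fun n => a n / a n.+1) @ \oo --> (1 : R) in
  [/\ cond_c -> cond_b, cond_b -> cond_a &
      [/\ cond_a -> tame H, cond_b -> tame H & cond_c -> tame H]].
Proof.
move=> cond_a cond_b cond_c.
have cb : cond_c -> cond_b by exact: (ratio_closed_range d_gt0 D_ball H_cnp).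
have ba : cond_b -> cond_a by exact: (closed_range_gleason d_gt0 D_ball H_cnp).
have ta : cond_a -> tame H by exact: (gleason_tame d_gt0 D_ball H_cnp).
by split=> //; split=> [//|/ba/ta //|/cb/ba/ta].
Qed.
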